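(* There is a polynomial-time algorithm that, given an instance $(M,d)$ of $d$-EDMC in which $M$ excludes a $t$-block pattern for some integer $t\ge 1$, either correctly decides the instance, or outputs an equivalent instance $(M',d)$ such that $M'$ is a principal submatrix of $M$ with $(d+1)^{\mathcal{O}(t^{2})}$ rows and columns.
   Context: A partial matrix is an $n\times n$ symmetric matrix with zero diagonal in which some off-diagonal entries are specified (nonnegative reals) and the others are unspecified (symmetrically). The problem $d$-EDMC: given a partial matrix $M$ and $d\in\mathbb{N}$, decide whether the unspecified entries can be filled in so that the resulting matrix $D$ satisfies $D_{ij}=\|p_i-p_j\|_2^2$ for some points $p_1,\dots,p_n\in\mathbb{R}^d$ (not necessarily distinct). Two instances are equivalent if both are yes-instances or both are no-instances. For disjoint $I_1,I_2\subseteq[n]$, $M[I_1,I_2]$ is the submatrix with rows $I_1$ and columns $I_2$; it is a $t$-block pattern if $|I_1|=|I_2|=t$ and every entry of it is unspecified. $M$ excludes a $t$-block pattern if no such $I_1,I_2$ exist. A principal submatrix is obtained by deleting the same set of row and column indices. Computation is in the real RAM model (basic real arithmetic in unit time). *)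

(* Defs.v *)
From mathcomp Require Import all_boot all_order all_algebra.
From mathcomp Require Import reals.

Set Implicit Arguments.
Unset Strict Implicit.
Unset Printing Implicit Defensive.

Import Order.TTheory GRing.Theory Num.Theory.
Local Open Scope ring_scope.

(** * Partial matrices and Euclidean distance matrix completion *)

Section Instances.
Variable R : realType.

(* [None] marks an unspecified entry. *)
Definition partial_matrix n (M : 'M[option R]_n) : Prop :=
  [/\ forall i, M i i = Some 0,
      forall i j, M i j = M j i
    & forall i j x, M i j = Some x -> 0 <= x].

(* The library norm on row vectors is the sup norm, so the squared Euclidean
   norm is written out. *)
Definition sqnorm2 d (v : 'rV[R]_d) : R := \sum_(k < d) v 0 k ^+ 2.

Definition edm n (d : nat) (D : 'M[R]_n) : Prop :=
  exists p : 'I_n -> 'rV[R]_d, forall i j, D i j = sqnorm2 (p i - p j).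

Definition completes n (D : 'M[R]_n) (M : 'M[option R]_n) : Prop :=
  forall i j x, M i j = Some x -> D i j = x.

Definition edmc n (d : nat) (M : 'M[option R]_n) : Prop :=
  exists D : 'M[R]_n, completes D M /\ edm d D.

Definition block_pattern n (t : nat) (M : 'M[option R]_n)
    (I1 I2 : {set 'I_n}) : Prop :=
  [/\ [disjoint I1 & I2], #|I1| = t, #|I2| = t
    & forall i j, i \in I1 -> j \in I2 -> M i j = None].

Definition excludes_block_pattern n (t : nat) (M : 'M[option R]_n) : Prop :=
  ~ exists I1 I2 : {set 'I_n}, block_pattern t M I1 I2.

(* [f] is the increasing enumeration of the indices that are not deleted. *)
Definition principal_submatrix m n (M' : 'M[option R]_m)
    (M : 'M[option R]_n) : Prop :=
  exists2 f : 'I_m -> 'I_n,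
    {homo f : i j / (i < j)%N} & M' = mxsub f f M.

End Instances.

(** * Real RAM *)

(* The memory consists of integer cells and real cells, both grouped in arrays
   named by natural numbers; a program names finitely many arrays and can
   address any cell [a[e]] of them indirectly.  Every arithmetic operation,
   memory access, comparison and assignment has cost 1, whatever the size of
   the operands.  There is no integer division and no rounding of reals, so
   that integers offer nothing beyond real arithmetic except addressing; the
   only constants are natural numbers. *)

(* [ISub] is truncated subtraction. *)
Inductive iexp :=
| ICst of nat
| ILoad of nat & iexp
| IAdd of iexp & iexp
| ISub of iexp & iexp
| IMul of iexp & iexp.

Inductive rexp :=
| RCast of iexp
| RLoad of nat & iexp
| RAdd of rexp & rexp
| RSub of rexp & rexp
| RMul of rexp & rexp
| RDiv of rexp & rexp.

Inductive bexp :=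
| ILe of iexp & iexp
| RLe of rexp & rexp
| BNot of bexp
| BAnd of bexp & bexp.

(* [IStore a e v] is [a[e] := v] for an integer array, [RStore a e v] the same
   for a real array. *)
Inductive prog :=
| Skip
| IStore of nat & iexp & iexp
| RStore of nat & iexp & rexp
| Seq of prog & prog
| If of bexp & prog & prog
| While of bexp & prog.

Fixpoint icost (e : iexp) : nat :=
  match e with
  | ICst _ => 1
  | ILoad _ e1 => (icost e1).+1
  | IAdd e1 e2 | ISub e1 e2 | IMul e1 e2 => (icost e1 + icost e2).+1
  end.

Fixpoint rcost (e : rexp) : nat :=
  match e with
  | RCast e1 => (icost e1).+1
  | RLoad _ e1 => (icost e1).+1
  | RAdd e1 e2 | RSub e1 e2 | RMul e1 e2 | RDiv e1 e2 =>
      (rcost e1 + rcost e2).+1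
  end.

Fixpoint bcost (b : bexp) : nat :=
  match b with
  | ILe e1 e2 => (icost e1 + icost e2).+1
  | RLe e1 e2 => (rcost e1 + rcost e2).+1
  | BNot b1 => (bcost b1).+1
  | BAnd b1 b2 => (bcost b1 + bcost b2).+1
  end.

Definition upd (T : Type) (m : nat -> nat -> T) (a k : nat) (v : T) :
    nat -> nat -> T :=
  fun a' k' => if (a' == a) && (k' == k) then v else m a' k'.

Section Semantics.
Variable R : realType.

Record state := State { imem : nat -> nat -> nat; rmem : nat -> nat -> R }.

Fixpoint ieval (s : state) (e : iexp) : nat :=
  match e with
  | ICst c => c
  | ILoad a e1 => imem s a (ieval s e1)
  | IAdd e1 e2 => (ieval s e1 + ieval s e2)%N
  | ISub e1 e2 => (ieval s e1 - ieval s e2)%N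
  | IMul e1 e2 => (ieval s e1 * ieval s e2)%N
  end.

(* Division by 0 yields 0; a program can always test for it beforehand. *)
Fixpoint reval (s : state) (e : rexp) : R :=
  match e with
  | RCast e1 => (ieval s e1)%:R
  | RLoad a e1 => rmem s a (ieval s e1)
  | RAdd e1 e2 => reval s e1 + reval s e2
  | RSub e1 e2 => reval s e1 - reval s e2
  | RMul e1 e2 => reval s e1 * reval s e2
  | RDiv e1 e2 => reval s e1 / reval s e2
  end.

Fixpoint beval (s : state) (b : bexp) : bool :=
  match b with
  | ILe e1 e2 => (ieval s e1 <= ieval s e2)%N
  | RLe e1 e2 => reval s e1 <= reval s e2
  | BNot b1 => ~~ beval s b1
  | BAnd b1 b2 => beval s b1 && beval s b2
  end.

(* [exec P s T s']: started in [s], [P] halts in [s'] after [T] operations. *)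
Inductive exec : prog -> state -> nat -> state -> Prop :=
| ExecSkip s : exec Skip s 1 s
| ExecIStore a e v s :
    exec (IStore a e v) s (icost e + icost v).+1
      (State (upd (imem s) a (ieval s e) (ieval s v)) (rmem s))
| ExecRStore a e v s :
    exec (RStore a e v) s (icost e + rcost v).+1
      (State (imem s) (upd (rmem s) a (ieval s e) (reval s v)))
| ExecSeq P1 P2 s s1 s2 T1 T2 :
    exec P1 s T1 s1 -> exec P2 s1 T2 s2 ->
    exec (Seq P1 P2) s (T1 + T2)%N s2
| ExecIfTrue b P1 P2 s s' T :
    beval s b -> exec P1 s T s' ->
    exec (If b P1 P2) s (bcost b + T)%N s'
| ExecIfFalse b P1 P2 s s' T :
    ~~ beval s b -> exec P2 s T s' ->
    exec (If b P1 P2) s (bcost b + T)%N s'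
| ExecWhileFalse b P s :
    ~~ beval s b -> exec (While b P) s (bcost b) s
| ExecWhileTrue b P s s1 s2 T1 T2 :
    beval s b -> exec P s T1 s1 -> exec (While b P) s1 T2 s2 ->
    exec (While b P) s (bcost b + T1 + T2)%N s2.

(** ** Encoding of instances *)

(* Row-major reading of [M]: cell [i * n + j] is [M i j], and [None] outside. *)
Definition flat n (M : 'M[option R]_n) (k : nat) : option R :=
  match insub (k %/ n)%N, insub (k %% n)%N with
  | Some i, Some j => M i j
  | _, _ => None
  end.

(* Integer array 0 holds [status; n; d], integer array 1 the indicator of the
   specified entries, real array 0 the entries themselves.  All other cells
   are initially 0, in particular the status. *)
Definition input_state n (d : nat) (M : 'M[option R]_n) : state :=
  State
    (fun a k => match a with
                | 0 => nth 0 [:: 0; n; d] k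
                | 1 => isSome (flat M k)
                | _ => 0
                end%N)
    (fun a k => if a is 0%N then odflt 0 (flat M k) else 0).

(* Status 0 announces an instance, 1 the answer yes, 2 the answer no. *)
Definition answers_yes (s : state) : Prop := imem s 0 0 = 1%N.
Definition answers_no (s : state) : Prop := imem s 0 0 = 2%N.

(* Cells that are not part of the encoding may have any content. *)
Definition outputs_instance (s : state) n (d : nat) (M : 'M[option R]_n) :
    Prop :=
  [/\ imem s 0 0 = 0%N, imem s 0 1 = n, imem s 0 2 = d,
      forall i j : 'I_n, imem s 1 (i * n + j)%N = isSome (M i j)
    & forall i j : 'I_n, rmem s 0 (i * n + j)%N = odflt 0 (M i j)].

End Semantics.

(* Main.v *)
Require Import Defs.
From mathcomp Require Import all_boot all_order all_algebra.
From mathcomp Require Import reals zify ring lra.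

Set Implicit Arguments.
Unset Strict Implicit.
Unset Printing Implicit Defensive.

Import Order.TTheory GRing.Theory Num.Theory.

(* Let G be the graph of the specified entries.  Its complement contains no
   K_{t,t}, so by a Kovari-Sos-Turan count repeatedly taking a vertex of
   maximum degree finds a clique K of G of size |V|^{1/O(t)}.

   In a realization p, write the points of K as rows (1, (D_ik)_{k in K}); they
   represent the points (p_i, |p_i|^2) on the paraboloid and span a space of
   dimension at most d + 2.  If row v of K is a combination of the rows of the
   neighbours of u in K other than v, then the combination determines the
   distance between u and v linearly.  Hence v can be deleted as soon as this
   holds for all neighbours u of v; a wrong value of D_uv, or a rank above
   d + 2, refutes realizability.

   When K is large such a v exists: pass to a subset K' of K no large part of
   which lies in a proper subspace of its span.  A vertex u whose neighbourhood
   in K' does not span misses a positive fraction of K', and K_{t,t}-freeness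
   bounds the number of those u.  Each of them needs to keep only a basis of
   its neighbourhood, so that some v in K' is redundant for all u. *)

(** * Structured programs *)

(** The program never reads [t], which enters only the analysis, so it cannot aim at a clique of
    prescribed size. It runs [n] rounds, each growing a clique for as long as possible and then
    trying its vertices in turn; the analysis shows that a round without deletion or refutation can
    occur only below the size bound. The exponent is quadratic because two counts are composed: a
    redundant row needs a clique of size [d.+3] to the power O(t), and a clique of size [s] needs
    about [(8 * s) ^ t] vertices. The rank that the test controls is [d.+3] and not [d.+2], since
    the row of [v] is left out of the elimination. Constant factors are absorbed by powers of
    [d.+1], which fails for [d = 0]; that case is decided directly. *)

Inductive cmd :=
| CSkip
| CIStore of nat & iexp & iexp
| CRStore of nat & iexp & rexp
| CSeq of cmd & cmd
| CIf of bexp & cmd & cmd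
| CFor of nat & nat & cmd.

Definition szE := ILoad 0 (ICst 1).

(* [CFor a k c] runs [c] with [a[0] = 0, ..., n + k - 1], where [n] is the
   size of the input instance. *)
Fixpoint compile (c : cmd) : prog :=
  match c with
  | CSkip => Skip
  | CIStore a e v => IStore a e v
  | CRStore a e v => RStore a e v
  | CSeq c1 c2 => Seq (compile c1) (compile c2)
  | CIf b c1 c2 => If b (compile c1) (compile c2)
  | CFor a k c1 =>
      Seq (IStore a (ICst 0) (ICst 0))
        (While (BNot (ILe (IAdd szE (ICst k)) (ILoad a (ICst 0))))
           (Seq (compile c1)
              (IStore a (ICst 0) (IAdd (ILoad a (ICst 0)) (ICst 1)))))
  end.

Fixpoint iwrites (c : cmd) : seq nat :=
  match c with
  | CIStore a _ _ => [:: a]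
  | CSeq c1 c2 | CIf _ c1 c2 => iwrites c1 ++ iwrites c2
  | CFor a _ c1 => a :: iwrites c1
  | _ => [::]
  end.

Fixpoint rwrites (c : cmd) : seq nat :=
  match c with
  | CRStore a _ _ => [:: a]
  | CSeq c1 c2 | CIf _ c1 c2 => rwrites c1 ++ rwrites c2
  | CFor _ _ c1 => rwrites c1
  | _ => [::]
  end.

(** Array 0 holds [n], which bounds every loop. Loop bodies and the first part of a sequence must
    leave it alone, so that all loops and costs refer to the same [n]; a last command may write the
    output there. *)
Fixpoint wf (c : cmd) : bool :=
  match c with
  | CSeq c1 c2 => [&& wf c1, wf c2 & 0 \notin iwrites c1]
  | CIf _ c1 c2 => wf c1 && wf c2
  | CFor a _ c1 => [&& wf c1, a != 0, a \notin iwrites c1 & 0 \notin iwrites c1]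
  | _ => true
  end.

(** In each round of a loop the guard costs 8 and the increment 6; the 11 is the last guard and the
    initialization. Both branches of a conditional are charged, which makes the bound a function of
    [n] alone. *)
Fixpoint cost (c : cmd) (n : nat) : nat :=
  match c with
  | CSkip => 1
  | CIStore _ e v => (icost e + icost v).+1
  | CRStore _ e v => (icost e + rcost v).+1
  | CSeq c1 c2 => cost c1 n + cost c2 n
  | CIf b c1 c2 => bcost b + (cost c1 n + cost c2 n)
  | CFor a k c1 => (n + k) * (cost c1 n + 14) + 11
  end.

(** One number serves as coefficient and exponent: the bounds [k * n.+1 ^ k] are then closed under
    sums, by adding the numbers, and under the factor [n + k] of a loop. *)
Lemma cost_poly c : exists k, forall n, cost c n <= k * n.+1 ^ k.
Proof.
have kle a b n : a <= b -> a * n.+1 ^ a <= b * n.+1 ^ b.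
  by move=> ab; rewrite leq_mul // leq_pexp2l.
have mono a b n : a * n.+1 ^ a + b * n.+1 ^ b <= (a + b) * n.+1 ^ (a + b).
  by rewrite mulnDl leq_add // leq_mul // leq_pexp2l // ?leq_addl ?leq_addr.
have cst a n : a <= a * n.+1 ^ a by rewrite leq_pmulr // expn_gt0.
elim: c => [|a e v|a e v|c1 [k1 h1] c2 [k2 h2]|b c1 [k1 h1] c2 [k2 h2]|a k c [k1 h1]].
- by exists 1 => n; apply: cst.
- by exists (icost e + icost v).+1 => n; apply: cst.
- by exists (icost e + rcost v).+1 => n; apply: cst.
- by exists (k1 + k2) => n; apply: leq_trans (mono _ _ _); apply: leq_add.
- exists (bcost b + (k1 + k2)) => n; apply: leq_trans (mono _ _ _).
  by apply: leq_add; [apply: cst|apply: leq_trans (mono _ _ _); apply: leq_add].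
- exists ((k.+1) * (k1 + 14).+1 + 11) => n /=.
  apply: leq_trans (mono _ _ _); apply: leq_add; last exact: cst.
  have h2 : cost c n + 14 <= (k1 + 14) * n.+1 ^ (k1 + 14).
    by apply: leq_trans (mono _ _ _); apply: leq_add; [apply: h1|apply: cst].
  have h3 : n + k <= k.+1 * n.+1.
    by rewrite mulSn; apply: leq_add; rewrite ?leqnSn ?leq_pmulr.
  apply: leq_trans (leq_mul h3 h2) _.
  rewrite mulnACA -expnS.
  apply: leq_mul; first by rewrite leq_mul2l leqnSn.
  by rewrite leq_pexp2l // leq_pmull.
Qed.

Section Run.
Variable R : realType.
Implicit Types s : state R.

Definition seti s a k v : state R := State (upd (imem s) a k v) (rmem s).
Definition setr s a k v : state R := State (imem s) (upd (rmem s) a k v).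

(** A total evaluator, possible because all loops are bounded. The counter is set from a list
    instead of incremented; the two agree because [wf] forbids the body to write it. *)
Fixpoint run (c : cmd) s : state R :=
  match c with
  | CSkip => s
  | CIStore a e v => seti s a (ieval s e) (ieval s v)
  | CRStore a e v => setr s a (ieval s e) (reval s v)
  | CSeq c1 c2 => run c2 (run c1 s)
  | CIf b c1 c2 => if beval s b then run c1 s else run c2 s
  | CFor a k c1 =>
      seti (foldl (fun s1 i => run c1 (seti s1 a 0 i)) s (iota 0 (imem s 0 1 + k)))
        a 0 (imem s 0 1 + k)
  end.

Definition agree c s s1 :=
  (forall a k, a \notin iwrites c -> imem s1 a k = imem s a k) /\
  (forall a k, a \notin rwrites c -> rmem s1 a k = rmem s a k).

Lemma agree_run c s : agree c s (run c s).
Proof.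
elim: c s => [|a e v|a e v|c1 h1 c2 h2|b c1 h1 c2 h2|a k c h] s /=.
- by [].
- by split=> // a' k' /=; rewrite mem_seq1 /upd => /negbTE->.
- by split=> // a' k' /=; rewrite mem_seq1 /upd => /negbTE->.
- by split=> a k /=; rewrite mem_cat => /norP[n1 n2];
    rewrite ?(h2 _).1 ?(h2 _).2 ?(h1 _).1 ?(h1 _).2.
- by split=> a k /=; rewrite mem_cat => /norP[n1 n2]; case: ifP => _;
    rewrite ?(h2 _).1 ?(h2 _).2 ?(h1 _).1 ?(h1 _).2.
- have aux l : agree (CFor a k c) s (foldl (fun s1 i => run c (seti s1 a 0 i)) s l).
    elim/last_ind: l => [|l x [ihi ihr]] //; rewrite foldl_rcons.
    split=> a' k' /= h1.
      rewrite (h _).1; last by apply: contra h1; rewrite inE orbC => ->.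
      move: (h1); rewrite inE => /norP[h2 _].
      by rewrite /= /upd (negbTE h2) /= ihi.
    by rewrite (h _).2 //= ihr.
  split=> a' k' /= h1; last by rewrite (aux _).2.
  by rewrite /upd; move: (h1); rewrite inE => /norP[/negbTE-> _] /=; rewrite (aux _).1.
Qed.

(** The step receives [agree] besides the invariant, so that invariants need not mention the arrays
    that the loop leaves unchanged. *)
Lemma run_for_gen (Inv : nat -> state R -> Prop) a k c s :
  Inv 0 s ->
  (forall i s1, i < imem s 0 1 + k -> agree (CFor a k c) s s1 -> Inv i s1 ->
     Inv i.+1 (run c (seti s1 a 0 i))) ->
  exists s1, [/\ Inv (imem s 0 1 + k) s1, agree (CFor a k c) s s1
     & run (CFor a k c) s = seti s1 a 0 (imem s 0 1 + k)].
Proof.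
move=> h0 hS /=; set N := imem s 0 1 + k in hS *.
eexists; split; last reflexivity.
- suff H m : m <= N -> Inv m (foldl (fun s1 i => run c (seti s1 a 0 i)) s (iota 0 m))
     /\ agree (CFor a k c) s (foldl (fun s1 i => run c (seti s1 a 0 i)) s (iota 0 m)).
    by case: (H N (leqnn _)).
  elim: m => [|m ih] hm //; rewrite -addn1 iotaD foldl_cat /= add0n addn1.
  have [i1 i2] := ih (ltnW hm); split; first exact: hS.
  set s1 := foldl _ _ _ in i2 *.
  split=> a' k' /= h1.
    rewrite (agree_run _ _).1; last by apply: contra h1; rewrite inE orbC => ->.
    by move: (h1); rewrite inE /= /upd => /norP[/negbTE-> _] /=; rewrite i2.1.
  by rewrite (agree_run _ _).2 //= i2.2.
- elim/last_ind: (iota 0 N) => [|l x [ihi ihr]] //; rewrite foldl_rcons.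
  split=> a' k' /= h1.
    rewrite (agree_run _ _).1; last by apply: contra h1; rewrite inE orbC => ->.
    by move: (h1); rewrite inE /= /upd => /norP[/negbTE-> _] /=; rewrite ihi.
  by rewrite (agree_run _ _).2 //= ihr.
Qed.

Lemma run_for (Inv : nat -> state R -> Prop) a k c s N :
  imem s 0 1 = N -> Inv 0 s ->
  (forall i s1, i < N + k -> agree (CFor a k c) s s1 -> Inv i s1 ->
     Inv i.+1 (run c (seti s1 a 0 i))) ->
  (forall s1 v, Inv (N + k) s1 -> Inv (N + k) (seti s1 a 0 v)) ->
  Inv (N + k) (run (CFor a k c) s).
Proof.
move=> <- h0 hS hv; have [s1 [h1 _ ->]] := run_for_gen h0 hS.
exact: hv.
Qed.


Lemma compile_exec c s : wf c ->
  exists2 T, exec (compile c) s T (run c s) & T <= cost c (imem s 0 1).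
Proof.
elim: c s => [|a e v|a e v|c1 h1 c2 h2|b c1 h1 c2 h2|a k c h] s.
- by move=> _; exists 1 => //; constructor.
- by move=> _; eexists; [constructor|].
- by move=> _; eexists; [constructor|].
- case/and3P=> w1 w2 z1 /=.
  have [T1 e1 l1] := h1 s w1; have [T2 e2 l2] := h2 (run c1 s) w2.
  exists (T1 + T2); first exact: ExecSeq e1 e2.
  by rewrite (agree_run _ _).1 // in l2; rewrite leq_add.
- move=> /=; case/andP=> w1 w2.
  have [T1 e1 l1] := h1 s w1; have [T2 e2 l2] := h2 s w2.
  case: ifP => hb.
    exists (bcost b + T1); first by constructor.
    by rewrite leq_add2l (leq_trans l1) // leq_addr.
  exists (bcost b + T2); first by constructor; rewrite ?hb.
  by rewrite leq_add2l (leq_trans l2) // leq_addl.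
- case/and4P => wc a0 ac zc /=; set N := imem s 0 1 + k.
  set f := fun s1 i => run c (seti s1 a 0 i).
  pose W := While (BNot (ILe (IAdd szE (ICst k)) (ILoad a (ICst 0))))
           (Seq (compile c)
              (IStore a (ICst 0) (IAdd (ILoad a (ICst 0)) (ICst 1)))).
  (* Induction on the number [m] of rounds still to run; [i] rounds are done. *)
  have loop m i s1 : m + i = N -> imem s1 0 1 = imem s 0 1 ->
    exists2 T, exec W (seti s1 a 0 i) T (seti (foldl f s1 (iota i m)) a 0 N)
       & T <= m * (cost c (imem s 0 1) + 14) + 8.
    elim: m i s1 => [|m ih] i s1 hm h1.
      rewrite -hm add0n; exists 8 => //.
      have -> : 8 = bcost (BNot (ILe (IAdd szE (ICst k)) (ILoad a (ICst 0)))) by [].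
      apply: ExecWhileFalse.
      by rewrite /= /upd !eqxx /= eq_sym (negbTE a0) /= h1 -/N -hm add0n leqnn.
    have [T1 e1 l1] := h (seti s1 a 0 i) wc.
    have hz : imem (f s1 i) 0 1 = imem s 0 1.
      by rewrite /f (agree_run _ _).1 //= /upd eq_sym (negbTE a0) /= h1.
    have [|T2 e2 l2] := ih i.+1 (f s1 i) _ hz; first by rewrite addnS -addSn.
    exists (8 + (T1 + 6) + T2); last first.
      have hc : imem (seti s1 a 0 i) 0 1 = imem s 0 1.
        by rewrite /= /upd eq_sym (negbTE a0).
      rewrite hc in l1.
      by rewrite mulSn; move: l1 l2; set x := cost _ _; set y := _ * _; lia.
    apply: (ExecWhileTrue (s1 := seti (f s1 i) a 0 i.+1)) => //.
    + rewrite /= /upd !eqxx /= [0 == a]eq_sym (negbTE a0) /= h1 -/N -hm -ltnNge.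
      by rewrite addSn ltnS leq_addl.
    + apply: (ExecSeq (s1 := f s1 i)); first exact: e1.
      have -> : i.+1 = ieval (f s1 i) (IAdd (ILoad a (ICst 0)) (ICst 1)).
        by rewrite /= /f (agree_run _ _).1 //= /upd !eqxx /= addn1.
      exact: ExecIStore.
  have [|T e l] := loop N 0 s _ erefl; first by rewrite addn0.
  exists (3 + T); last by move: l; rewrite -/N; lia.
  by apply: (ExecSeq (s1 := seti s a 0 0)) => //; exact: ExecIStore.
Qed.
End Run.

(** * Graphs whose complement has no K_{t,t} *)

Lemma leq_expl a b k : a <= b -> a ^ k <= b ^ k.
Proof. by case: k => // k; rewrite leq_exp2r. Qed.

Lemma subset_of_card (T : finType) (A : {set T}) k : k <= #|A| ->
  exists2 B : {set T}, B \subset A & #|B| = k.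
Proof.
case/card_geqP => l [ul sl sub]; exists [set x in l].
  by apply/subsetP => x; rewrite inE => /sub.
by rewrite cardsE (card_uniqP ul).
Qed.

Section Zarankiewicz.
Variable T : finType.
Implicit Types (e : rel T) (U K C V : {set T}).

(* Choose the elements of [K'] one after the other, each time the one that is
   related to the largest part of what is left of [U]. *)
Lemma common_neighbours e U K t a :
  U != set0 -> {in U, forall u, t + a <= #|[set k in K | e u k]|} ->
  exists K' U' : {set T}, [/\ K' \subset K /\ #|K'| = t, U' \subset U,
    {in U' & K', forall u k, e u k} & #|U| * a ^ t <= #|U'| * #|K| ^ t].
Proof.
elim: t U K => [|t ih] U K U0 hU.
  exists set0, U; split; rewrite ?sub0set ?cards0 ?expn0 //.
  by move=> u k _; rewrite inE.
pose Uk k := [set u in U | e u k].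
(* Averaging over [K]: counting related pairs from both sides, the numbers [#|Uk k|] sum to at least
   [#|U| * (t.+1 + a)], so not all of them lie below the mean. *)
have [k kK hk] : exists2 k, k \in K & #|U| * (t.+1 + a) <= #|Uk k| * #|K|.
  apply/exists_inP; apply: contraT; rewrite negb_exists_in => /forall_inP hn.
  have : \sum_(k in K) (#|Uk k| * #|K|).+1 <= \sum_(k in K) #|U| * (t.+1 + a).
    by apply: leq_sum => k /hn; rewrite -ltnNge.
  have dc : \sum_(k in K) #|Uk k| = \sum_(u in U) #|[set k in K | e u k]|.
    under eq_bigr => k _ do rewrite -sum1_card.
    under [RHS]eq_bigr => u _ do rewrite -sum1_card.
    rewrite (exchange_big_dep (fun u => u \in U)) /=; last first.
      by move=> k u _; rewrite inE => /andP[].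
    apply: eq_bigr => u uU; apply: eq_bigl => k; rewrite !inE uU.
    by rewrite andbC.
  have l1 : #|U| * (t.+1 + a) <= \sum_(k in K) #|Uk k|.
    by rewrite dc -sum_nat_const; apply: leq_sum.
  have K0 : 0 < #|K|.
    case/set0Pn: U0 => u /hU; rewrite addSn => h.
    by apply: leq_trans (leq_trans _ h) (subset_leq_card _) => //;
      apply/subsetP => k; rewrite inE => /andP[].
  rewrite sum_nat_const; under eq_bigr => k _ do rewrite -addn1.
  rewrite big_split /= -big_distrl /= sum_nat_const muln1.
  by have := leq_mul l1 (leqnn #|K|); lia.
have [U0k|Uk0] := eqVneq (Uk k) set0.
  by move: hk; rewrite U0k cards0 mul0n leqn0 muln_eq0 cards_eq0 (negbTE U0).
(* Removing [k] costs each [u] one related element, so [t.+1 + a] drops to the [t + a] of the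
   induction hypothesis; only the factor [a] is kept in the final count. *)
have [|K' [U' [[sK cK] sU hb hc]]] := ih (Uk k) (K :\ k) Uk0.
  move=> u; rewrite inE => /andP[uU euk].
  have := hU u uU; rewrite (cardsD1 k) inE kK euk /= add1n addSn ltnS.
  move=> /leq_trans; apply; apply: subset_leq_card.
  by apply/subsetP => j; rewrite !inE => /and3P[-> -> ->].
exists (k |: K'), U'; split.
- rewrite subUset sub1set kK (subset_trans sK) ?subD1set // cardsU1 cK.
  by rewrite (contra (subsetP sK k)) // !inE eqxx.
- by apply: subset_trans sU _; apply/subsetP => u; rewrite inE => /andP[].
- move=> u j uU; rewrite !inE => /predU1P[->|jK]; last exact: hb.
  by have := subsetP sU _ uU; rewrite inE => /andP[].
- have kk : #|K :\ k| <= #|K| by rewrite subset_leq_card // subD1set.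
  rewrite !expnS !mulnA.
  apply: leq_trans (_ : #|U'| * #|K :\ k| ^ t * #|K| <= _); last first.
    by rewrite -!mulnA leq_mul2l mulnC leq_mul2l leq_expl ?orbT.
  apply: leq_trans (leq_mul hc (leqnn _)).
  have := leq_trans (_ : #|U| * a <= _) hk.
  rewrite leq_mul2l leq_addl orbT => /(_ isT) h.
  by rewrite [X in _ <= X]mulnAC leq_mul2r h orbT.
Qed.

(** [I] and [J] may overlap: for a reflexive [e] a common element is itself a related pair. *)
Definition block_free t e := forall I J : {set T}, #|I| = t -> #|J| = t ->
  exists i j, [/\ i \in I, j \in J & e i j].

(** Kovari-Sos-Turan for the complement of [e]: no element of [U'] is related to any of the [t]
    elements of [K'], so [U'] has at most [t.-1] elements, which limits [U] through the density
    bound. *)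
Lemma block_free_bound e t a U K : 0 < t -> block_free t e ->
  {in U, forall u, t + a <= #|[set k in K | ~~ e u k]|} ->
  #|U| * a ^ t <= t.-1 * #|K| ^ t.
Proof.
move=> t0 bf hU; have [->|U0] := eqVneq U set0; first by rewrite cards0.
have [K' [U' [[sK cK] sU hb hc]]] := @common_neighbours (fun i j => ~~ e i j) _ _ _ _ U0 hU.
apply: leq_trans hc _; rewrite leq_mul2r; apply/orP; right.
rewrite -ltnS prednK // ltnNge; apply/negP => /subset_of_card[J sJ cJ].
have [j [k [jJ kK]]] := bf _ _ cJ cK.
by rewrite (negbTE (hb j k (subsetP sJ _ jJ) kK)).
Qed.


Section GreedyClique.
Variables (e : rel T) (t : nat).
Hypotheses (t_gt0 : 0 < t) (e_free : block_free t e).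

Definition greedy_step K C K' C' :=
  (C = set0 /\ K' = K /\ C' = C) \/
  exists b, [/\ b \in C,
    {in C, forall i, #|[set j in C | e i j]| <= #|[set j in C | e b j]|},
    K' = b |: K & C' = [set j in C | e b j] :\ b].

(** The vertices with at least [t + a] non-neighbours in [C] are too few to fill [C]. Some [v]
    therefore misses fewer than [2 * a] candidates, the vertex of maximum degree misses no more, and
    one further candidate is lost by taking it out. *)
Lemma greedy_step_card a K C K' C' :
  [disjoint K & C] ->
  t <= a -> t.-1 * #|C| ^ t < #|C| * a ^ t -> greedy_step K C K' C' ->
  #|K'| = #|K|.+1 /\ #|C| <= #|C'| + 2 * a.
Proof.
move=> dis ta hC [[C0 _]|[b [bC bmax -> ->]]].
  by move: hC; rewrite C0 cards0 mul0n ltn0.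
split; first by rewrite cardsU1 (disjointFl dis bC).
have [v vC hv] : exists2 v, v \in C & #|[set j in C | ~~ e v j]| < t + a.
  apply/exists_inP; apply: contraLR hC; rewrite negb_exists_in -leqNgt.
  move=> /forall_inP hn; apply: (@block_free_bound e) => // v /hn.
  by rewrite -leqNgt.
have split_deg i : #|C| = #|[set j in C | e i j]| + #|[set j in C | ~~ e i j]|.
  rewrite -(cardsID [set j | e i j] C); congr (_ + _); apply: eq_card => j;
    by rewrite !inE // andbC.
have := bmax _ vC; have := split_deg v.
rewrite (cardsD1 b [set j in C | e b j]).
by case: (b \in _) => /=; lia.
Qed.


Definition clique K := {in K &, forall i j, e i j}.

(** The size part, after [q] steps, is stated for all targets [s] at once, since the search does not
    know its target. With [a = #|V| %/ (4 * s)], each of the first [s] steps loses at most [2 * a]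
    candidates, altogether at most half of [V]; the threshold on [#|V|] keeps the counting bound in
    force on the other half. *)
Definition greedy_inv V q K C :=
  [/\ K \subset V, C \subset V, [disjoint K & C], clique K
    & {in K & C, forall i j, e i j}] /\
  forall s, 0 < s -> 2 * (t * (8 * s) ^ t) <= #|V| ->
    minn q s <= #|K| /\ (q <= s -> #|V| <= #|C| + 2 * (#|V| %/ (4 * s)) * q).

Lemma greedy_inv_step V q K C K' C' : reflexive e -> symmetric e ->
  greedy_inv V q K C -> greedy_step K C K' C' -> greedy_inv V q.+1 K' C'.
Proof.
move=> er es [[KV CV dis clK crK] size_inv] st.
have KK' : K \subset K'.
  by case: st => [[_ [-> _]]|[b [_ _ -> _]]] //; rewrite subsetUr.
split.
  case: st => [[_ [-> ->]]|[b [bC _ -> ->]]] //.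
  have CC' : [set j in C | e b j] :\ b \subset C.
    by apply/subsetP => j; rewrite !inE => /and3P[].
  split.
  - by rewrite subUset sub1set (subsetP CV).
  - exact: subset_trans CC' CV.
  - rewrite -setI_eq0; apply/eqP/setP => j; rewrite !inE.
    have [->|_] := eqVneq j b; first by rewrite andbF.
    by case jK: (j \in K); rewrite ?(disjointFr dis jK).
  - move=> i j; rewrite !inE => /predU1P[->|iK] /predU1P[->|jK] //.
    + by rewrite es crK.
    + exact: crK.
    + exact: clK.
  - move=> i j; rewrite !inE => /predU1P[->|iK] /and3P[_ jC ebj] //.
    exact: crK.
move=> s s0 hV; have [h1 h2] := size_inv s s0 hV.
have [qs|sq] := ltnP q s; last first.
  split=> //.
  rewrite (minn_idPr sq) in h1; rewrite (minn_idPr (leqW sq)).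
  by rewrite (leq_trans h1) ?subset_leq_card.
have {}h2 := h2 (ltnW qs).
set a := #|V| %/ (4 * s) in h2 *.
have p0 : 1 <= (8 * s) ^ t by rewrite expn_gt0 muln_gt0 s0.
have ps : 8 * s <= (8 * s) ^ t.
  by rewrite -{1}[8 * s]expn1 leq_pexp2l // muln_gt0 s0.
have ta : t <= a.
  rewrite /a leq_divRL ?muln_gt0 //; apply: leq_trans hV.
  by have := leq_mul (leqnn t) ps; lia.
(* Rounding: [#|V|] is below [4 * s * a.+1], and [a] is positive, being at least [t]. *)
have a1 : #|V| <= 8 * s * a.
  have := ltn_ceil #|V| (_ : 0 < 4 * s); rewrite -/a => /(_ _).
  by rewrite muln_gt0 s0 => /(_ isT); nia.
have a2 : a * (4 * s) <= #|V| := leq_trunc_div _ _.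
have hC : #|V| <= 2 * #|C| by nia.
(* After cancelling [a ^ t] it suffices that [t.-1 * (8 * s) ^ t < #|C|]; half of [V] already has at
   least [t * (8 * s) ^ t] elements. *)
have [] := greedy_step_card dis ta _ st.
  have c1 : #|C| ^ t <= (8 * s) ^ t * a ^ t.
    by rewrite -expnMn leq_expl // (leq_trans _ a1) // subset_leq_card.
  apply: leq_ltn_trans (leq_mul (leqnn t.-1) c1) _.
  rewrite mulnA ltn_pmul2r ?expn_gt0 ?(leq_trans t_gt0 ta) //.
  apply: leq_trans (_ : t * (8 * s) ^ t <= _); last by lia.
  by rewrite ltn_pmul2r // prednK.
move=> -> hC'; split; last by move: h2 hC'; clear; nia.
by rewrite (minn_idPl (ltnW qs)) in h1; rewrite (minn_idPl qs) ltnS.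
Qed.

Lemma greedy_inv0 V : greedy_inv V 0 set0 V.
Proof.
split; last by move=> s _ _; rewrite min0n muln0 addn0.
split; rewrite ?sub0set // -?setI_eq0 ?set0I // => i j; by rewrite inE.
Qed.

End GreedyClique.
End Zarankiewicz.

(** * Redundant rows *)

Section RowSpan.
Variables (F : fieldType) (n m : nat) (X : 'M[F]_(n, m)).
Implicit Types S K : {set 'I_n}.

Definition row_span S : 'M[F]_m := (\sum_(i in S) <<row i X>>)%MS.

Lemma row_span_sub S i : i \in S -> (row i X <= row_span S)%MS.
Proof. by move=> iS; rewrite -genmxE (sumsmx_sup i). Qed.

Lemma row_spanS S S' : S \subset S' -> (row_span S <= row_span S')%MS.
Proof.
move=> /subsetP sub; apply/sumsmx_subP => i /sub iS'.
by rewrite genmxE row_span_sub.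
Qed.

Lemma row_span_le S m' (A : 'M[F]_(m', m)) :
  (forall i, i \in S -> (row i X <= A)%MS) -> (row_span S <= A)%MS.
Proof. by move=> h; apply/sumsmx_subP => i /h; rewrite genmxE. Qed.

(** If row [v] lies outside the span of the other rows, adding it to their basis raises the rank,
    which pays for the extra element. *)
Lemma row_span_basis S : exists B : {set 'I_n},
  [/\ B \subset S, #|B| <= \rank (row_span S) & (row_span S <= row_span B)%MS].
Proof.
have [k] := ubnP #|S|; elim: k S => // k ih S; rewrite ltnS => hk.
have [->|[v vS]] := set_0Vmem S; first by exists set0; rewrite sub0set cards0.
have [|B [BS cB sB]] := ih (S :\ v).
  by apply: leq_trans hk; rewrite (cardsD1 v S) vS.
have vB : v \notin B by apply/negP => /(subsetP BS); rewrite !inE eqxx.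
have BS' : B \subset S by rewrite (subset_trans BS) ?subD1set.
have hv i : i \in S -> i != v -> (row i X <= row_span B)%MS.
  by move=> iS iv; apply: submx_trans sB; rewrite row_span_sub // !inE iv.
have [vin|vout] := boolP (row v X <= row_span (S :\ v))%MS.
  exists B; split=> //.
    by apply: leq_trans cB _; rewrite mxrankS // row_spanS ?subD1set.
  apply: row_span_le => i iS; have [->|] := eqVneq i v; last exact: hv.
  exact: submx_trans vin sB.
exists (v |: B); split.
- by rewrite subUset sub1set vS.
- rewrite cardsU1 vB add1n; apply: leq_ltn_trans cB _.
  apply: rank_ltmx; rewrite /ltmx row_spanS ?subD1set //=.
  apply: contra vout; apply: submx_trans; exact: row_span_sub.
- apply: row_span_le => i iS; have [->|iv] := eqVneq i v.
    by rewrite row_span_sub ?setU11.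
  by apply: submx_trans (hv i iS iv) (row_spanS _); rewrite subsetUr.
Qed.

(** Descent on the rank: as long as a subset missing at most [d] elements has a smaller span, pass
    to it. At most [r] passes occur, whence the loss [r * d]. Here [d] is any number, not the
    dimension. *)
Lemma row_span_core r d K : \rank (row_span K) <= r ->
  exists K' : {set 'I_n}, [/\ K' \subset K, #|K| <= #|K'| + r * d
    & forall S, S \subset K' -> #|K'| <= #|S| + d ->
        (row_span K' <= row_span S)%MS].
Proof.
elim: r K => [|r ih] K rK.
  exists K; split=> //; first by rewrite leq_addr.
  by move=> S _ _; move: rK; rewrite leqn0 mxrank_eq0 => /eqP->; rewrite sub0mx.
have [/exists_inP[S SK /andP[cS nS]]|hn] :=
  boolP [exists S in powerset K, (#|K| <= #|S| + d) && ~~ (row_span K <= row_span S)%MS].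
  rewrite powersetE in SK.
  have [|K' [K'S cK' hK']] := ih S.
    rewrite -ltnS; apply: leq_trans rK; apply: rank_ltmx.
    by rewrite /ltmx row_spanS.
  exists K'; split=> //; first exact: subset_trans SK.
  by rewrite mulSn; move: cS cK'; lia.
exists K; split=> //; first by rewrite leq_addr.
move=> S SK cS; apply: contraR hn => hS; apply/exists_inP; exists S.
  by rewrite powersetE.
by rewrite cS.
Qed.

Lemma redundant_row (e : rel 'I_n) t r K :
  0 < t -> 0 < r -> block_free t e -> \rank (row_span K) <= r ->
  2 * r * (t * (4 * r) ^ t) <= #|K| ->
  exists2 v, v \in K & forall u, e u v ->
    (row v X <= row_span ([set b in K | e u b] :\ v))%MS.
Proof.
move=> t0 r0 ef rK; set d := t * (4 * r) ^ t => cK.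
have p0 : 4 * r <= (4 * r) ^ t.
  by rewrite -{1}[4 * r]expn1 leq_pexp2l // muln_gt0 r0.
have dt : 4 * t <= d by have := leq_mul (leqnn t) p0; rewrite -/d; nia.
(* Trimming to exactly [2 * r * d] elements: the core then keeps at least [r * d], and the counting
   bound below also needs an upper bound on its size. *)
have [K1 K1K cK1] := subset_of_card cK.
have [|K' [K'K1 cK' core]] := @row_span_core r d K1.
  by apply: leq_trans rK; rewrite mxrankS // row_spanS.
have K'K : K' \subset K := subset_trans K'K1 K1K.
pose N u := [set b in K' | e u b].
have NK' u : N u \subset K' by apply/subsetP => b; rewrite inE => /andP[].
pose U := [set u | d <= #|[set b in K' | ~~ e u b]|].
(* The [d] missing elements are read as [t + (d - t)]. Since [4 * t <= d], [#|K'|] is at most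
   [4 * r * (d - t)], so [#|U|] is at most [t.-1 * (4 * r) ^ t]. *)
have cU : #|U| < d.
  have : #|U| * (d - t) ^ t <= t.-1 * #|K'| ^ t.
    apply: (@block_free_bound _ e) => // u; rewrite inE subnKC //.
    by apply: leq_trans dt; rewrite leq_pmull.
  have le : #|K'| <= 4 * r * (d - t).
    by apply: leq_trans (subset_leq_card K'K1) _; rewrite cK1; move: dt; clear; nia.
  move=> /leq_trans /(_ (leq_mul (leqnn _) (leq_expl t le))).
  have dt0 : 0 < d - t by lia.
  rewrite expnMn mulnA leq_pmul2r ?expn_gt0 ?dt0 // => /leq_ltn_trans; apply.
  by rewrite /d ltn_pmul2r ?expn_gt0 ?muln_gt0 ?r0 // prednK.
have [B hB] := fin_all_exists (fun u => row_span_basis (N u)).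
(* Fewer than [d] bases of at most [r] elements each cannot cover the at least [r * d] elements of
   the core. *)
have [v vK' vB] : exists2 v, v \in K' & v \notin \bigcup_(u in U) B u.
  apply/subsetPn; apply: contraTN (_ : #|K'| > #|U| * r) => [h|].
    rewrite -leqNgt; apply: leq_trans (subset_leq_card h) _.
    rewrite -sum_nat_const; apply: leq_trans (_ : \sum_(u in U) #|B u| <= _).
      elim/big_rec2: _ => [|u y x _ ih]; first by rewrite cards0.
      by rewrite (leq_trans (leq_card_setU _ _).1) // leq_add2l.
    apply: leq_sum => u _; case: (hB u) => _ /leq_trans-> //.
    by apply: leq_trans rK; rewrite mxrankS // row_spanS // (subset_trans (NK' u)).
  by move: cK' cU; rewrite cK1; clear -r0; nia.
exists v; first exact: (subsetP K'K).
move=> u euv; set S := _ :\ v.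
have [uU|uU] := boolP (u \in U).
  have vBu : v \notin B u by apply: contra vB => h; apply/bigcupP; exists u.
  case: (hB u) => sB _ spB.
  apply: submx_trans (_ : row_span (N u) <= _)%MS.
    by apply: row_span_sub; rewrite inE vK'.
  apply: submx_trans spB _; apply: row_spanS; apply/subsetP => b bB.
  have := subsetP sB b bB; rewrite !inE => /andP[/(subsetP K'K)-> ->].
  by rewrite !andbT; apply: contraNneq vBu => <-.
apply: submx_trans (row_span_sub vK') _.
(* A vertex outside [U] misses fewer than [d] elements of [K']; leaving out [v] as well makes at
   most [d], which the core tolerates. *)
apply: submx_trans (core (N u :\ v) _ _) _.
- by rewrite (subset_trans (subD1set _ _)).
- have := cardsID [set b | e u b] K'.
  rewrite inE -ltnNge in uU.
  have -> : K' :&: [set b | e u b] = N u by apply/setP => b; rewrite !inE.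
  have -> : K' :\: [set b | e u b] = [set b in K' | ~~ e u b].
    by apply/setP => b; rewrite !inE andbC.
  rewrite (cardsD1 v (N u)); move: uU; move: #|[set b in K' | ~~ e u b]| #|N u :\ v| #|K'|.
  by clear; clearbody d; case: (v \in _) => /= x y z; lia.
- apply: row_spanS; apply/subsetP => b; rewrite !inE => /and3P[-> bK ->].
  by rewrite (subsetP K'K).
Qed.
End RowSpan.

(** * Realizations *)

Section Realizations.
Variables (R : realType) (n d : nat) (M : 'M[option R]_n).
Hypothesis M_partial : partial_matrix M.
Local Open Scope ring_scope.
Implicit Types (V K S : {set 'I_n}) (p : 'I_n -> 'rV[R]_d) (l : 'I_n -> R).

Definition spec (i j : 'I_n) : bool := isSome (M i j).
Definition dst (i j : 'I_n) : R := odflt 0 (M i j).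

Lemma spec_refl : reflexive spec.
Proof. by case: M_partial => h _ _ i; rewrite /spec h. Qed.

Lemma spec_sym : symmetric spec.
Proof. by case: M_partial => _ h _ i j; rewrite /spec h. Qed.

Lemma dst_sym i j : dst i j = dst j i.
Proof. by case: M_partial => _ h _; rewrite /dst h. Qed.

Lemma dstxx i : dst i i = 0.
Proof. by case: M_partial => h _ _; rewrite /dst h. Qed.

Definition realizes V p :=
  {in V &, forall i j, spec i j -> sqnorm2 (p i - p j) = dst i j}.

Definition realizable V := exists p, realizes V p.

Lemma sqnorm2N (x : 'rV[R]_d) : sqnorm2 (- x) = sqnorm2 x.
Proof. by apply: eq_bigr => k _; rewrite mxE sqrrN. Qed.

Lemma sqnorm2_eq0 (x : 'rV[R]_d) : sqnorm2 x = 0 -> x = 0.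
Proof.
move=> h; apply/rowP => k; rewrite mxE; apply/eqP; rewrite -sqrf_eq0; apply/eqP.
by move: h k (erefl true) => /psumr_eq0P h k _; apply: h => // i _; exact: sqr_ge0.
Qed.

(** Steiner's identity, with weights of either sign. In each coordinate, with [m] the weighted mean
    and [q] the weighted second moment, the double sum is twice the variance [q - m ^+ 2]. Doubling
    both sides avoids fractions. *)
Lemma sqnorm2_comb p l x : \sum_b l b = 1 ->
  2 * sqnorm2 (x - \sum_b l b *: p b) =
  2 * (\sum_b l b * sqnorm2 (x - p b))
  - \sum_b \sum_c l b * l c * sqnorm2 (p b - p c).
Proof.
move=> l1.
have -> : \sum_b l b * sqnorm2 (x - p b) =
    \sum_(k < d) \sum_b l b * (x - p b) 0 k ^+ 2.
  by rewrite [RHS]exchange_big; apply: eq_bigr => b _; rewrite mulr_sumr.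
have -> : \sum_b \sum_c l b * l c * sqnorm2 (p b - p c) =
    \sum_(k < d) \sum_b \sum_c l b * l c * (p b - p c) 0 k ^+ 2.
  rewrite [RHS]exchange_big; apply: eq_bigr => b _.
  by rewrite [RHS]exchange_big; apply: eq_bigr => c _; rewrite mulr_sumr.
rewrite !mulr_sumr -sumrB.
apply: eq_bigr => k _; rewrite !mxE summxE.
set m := \sum_b l b * p b 0 k; set q := \sum_b l b * p b 0 k ^+ 2.
under [X in (_ - X) ^+ 2]eq_bigr => b _ do rewrite mxE.
have -> : \sum_b l b * (x - p b) 0 k ^+ 2 = x 0 k ^+ 2 - 2 * x 0 k * m + q.
  have e y : y = \sum_b l b * y by rewrite -mulr_suml l1 mul1r.
  rewrite [x 0 k ^+ 2]e /m mulr_sumr -sumrB -big_split /=.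
  by apply: eq_bigr => b _; rewrite !mxE; ring.
suff -> : \sum_b \sum_c l b * l c * (p b - p c) 0 k ^+ 2 = 2 * q - 2 * m ^+ 2.
  by rewrite -/m; ring.
transitivity (\sum_b (l b * p b 0 k ^+ 2 + l b * q - 2 * l b * p b 0 k * m)).
  apply: eq_bigr => b _.
  have e y : y = \sum_c l c * y by rewrite -mulr_suml l1 mul1r.
  rewrite [X in X + _ - _]e /q /m !mulr_sumr -big_split -sumrB /=.
  by apply: eq_bigr => c _; rewrite !mxE; ring.
rewrite sumrB big_split /= -mulr_suml l1 -mulr_suml.
have -> : \sum_i 2 * l i * p i 0 k = 2 * m.
  by rewrite /m mulr_sumr; apply: eq_bigr => b _; rewrite mulrA.
by rewrite -/q; ring.
Qed.

(* An affine dependency of [v] on other points of [K], stated for the points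
   [(p, |p|^2)] lifted to the paraboloid: the lift is what makes the dependency
   linear in the distances. *)
Definition dependency K u v l :=
  [/\ forall b, l b != 0 -> [/\ b \in K, spec u b & b != v],
      \sum_b l b = 1
    & {in K, forall k, dst v k = \sum_b l b * dst b k}].

(** The correction term of [sqnorm2_comb] vanishes: the dependency at each [c] of the support turns
    it into the combination of the [dst c v], and the dependency at [v] turns that into [dst v v].
    Only [K :\ v] has to be realized. *)
Lemma dependency_dist K u v l p x : clique spec K -> v \in K ->
  dependency K u v l -> realizes (K :\ v) p ->
  sqnorm2 (x - \sum_b l b *: p b) = \sum_b l b * sqnorm2 (x - p b).
Proof.
move=> cK vK [ls l1 ld] rp; have := sqnorm2_comb p x l1.
suff -> : \sum_b \sum_c l b * l c * sqnorm2 (p b - p c) = 0 by lra.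
transitivity (\sum_c l c * \sum_b l b * dst b c).
  rewrite exchange_big /=; apply: eq_bigr => c _; rewrite mulr_sumr.
  apply: eq_bigr => b _.
  have [->|/ls[bK _ bv]] := eqVneq (l b) 0; first by rewrite !(mul0r, mulr0).
  have [->|/ls[cK' _ cv]] := eqVneq (l c) 0; first by rewrite !(mul0r, mulr0).
  by rewrite rp ?in_setD1 ?bv ?cv ?cK // mulrA [l c * _]mulrC.
transitivity (\sum_c l c * dst c v); last by rewrite -ld // dstxx.
apply: eq_bigr => c _.
have [->|/ls[cK' _ cv]] := eqVneq (l c) 0; first by rewrite !mul0r.
by rewrite -ld // dst_sym.
Qed.

(** As [K] is a clique, the combination is at the right distance from all of [K :\ v], also from
    points that are not neighbours of [u]. This is what allows comparing the points obtained for
    different [u]. *)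
Lemma dependency_extend K u v l p : clique spec K -> v \in K ->
  dependency K u v l -> realizes (K :\ v) p ->
  forall k, k \in K :\ v -> sqnorm2 (p k - \sum_b l b *: p b) = dst v k.
Proof.
move=> cK vK dl rp k kK; rewrite (dependency_dist _ cK vK dl rp).
case: dl => ls _ ->; last by move: kK; rewrite inE => /andP[].
apply: eq_bigr => b _.
have [->|/ls[bK _ bv]] := eqVneq (l b) 0; first by rewrite !mul0r.
rewrite !inE in kK; case/andP: kK => kv kK.
by rewrite rp ?in_setD1 ?bv ?kv ?cK // dst_sym.
Qed.

Lemma realizesS V V' p : V \subset V' -> realizes V' p -> realizes V p.
Proof. by move=> /subsetP s h i j /s iV /s jV; apply: h. Qed.

(** In a realization [v] must sit at the combination, since its squared distance to it is [dst v v].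
    The support consists of neighbours of [u], so the distance from [u] follows. *)
Lemma dependency_forces V K u v l : realizable V -> K \subset V ->
  clique spec K -> v \in K -> u \in V -> spec u v -> dependency K u v l ->
  dst u v = \sum_b l b * dst u b.
Proof.
move=> [p rp] KV cK vK uV suv dl.
have rK : realizes (K :\ v) p.
  by apply: realizesS rp; rewrite (subset_trans (subD1set _ _)).
have vV := subsetP KV _ vK.
have pv : p v = \sum_b l b *: p b.
  apply/eqP; rewrite -subr_eq0; apply/eqP/sqnorm2_eq0.
  rewrite (dependency_dist _ cK vK dl rK).
  rewrite -[RHS](dstxx v); case: dl => ls _ ->//.
  apply: eq_bigr => b _.
  have [->|/ls[bK _ bv]] := eqVneq (l b) 0; first by rewrite !mul0r.
  by rewrite rp ?(subsetP KV) ?cK // dst_sym.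
rewrite -rp // pv (dependency_dist _ cK vK dl rK).
case: dl => ls _ _; apply: eq_bigr => b _.
have [->|/ls[bK sub bv]] := eqVneq (l b) 0; first by rewrite !mul0r.
by rewrite rp // (subsetP KV).
Qed.

Lemma realizable_delete V K v : K \subset V -> clique spec K -> v \in K ->
  {in V, forall u, spec u v ->
     exists2 l, dependency K u v l & dst u v = \sum_b l b * dst u b} ->
  realizable (V :\ v) -> realizable V.
Proof.
move=> KV cK vK dep [p rp].
have rK : realizes (K :\ v) p by apply: realizesS rp; rewrite setSD.
have vV := subsetP KV _ vK.
(* [v] is its own neighbour, so the hypothesis at [u = v] supplies coefficients for placing the
   deleted point. *)
have [l dl _] := dep v vV (spec_refl v).
set z := \sum_b l b *: p b.
have hz u : u \in V :\ v -> spec u v -> sqnorm2 (p u - z) = dst u v.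
  rewrite inE => /andP[uv uV] suv; rewrite inE in uv.
  have [l' dl' ->] := dep u uV suv.
  (* The points given by [l] and [l'] coincide: their squared distance is the [l']-combination of
     the distances from [v], which is [dst v v]. *)
  have -> : z = \sum_b l' b *: p b.
    apply/eqP; rewrite -subr_eq0; apply/eqP/sqnorm2_eq0.
    rewrite (dependency_dist _ cK vK dl' rK) -[RHS](dstxx v).
    case: dl' => ls _ -> //; apply: eq_bigr => b _.
    have [->|/ls[bK _ bv]] := eqVneq (l' b) 0; first by rewrite !mul0r.
    rewrite -sqnorm2N opprB (dependency_extend cK vK dl rK) ?in_setD1 ?bv //.
    by rewrite dst_sym.
  rewrite (dependency_dist _ cK vK dl' rK); case: dl' => ls _ _.
  apply: eq_bigr => b _.
  have [->|/ls[bK sub bv]] := eqVneq (l' b) 0; first by rewrite !mul0r.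
  by rewrite rp ?in_setD1 ?uv ?uV ?bv ?(subsetP KV).
exists (fun i => if i == v then z else p i) => i j iV jV sij.
have [iv|iv] := eqVneq i v; have [jv|jv] := eqVneq j v.
- subst; rewrite dstxx subrr; apply: big1 => k _; by rewrite mxE expr0n.
- rewrite -sqnorm2N opprB dst_sym iv hz ?in_setD1 ?jv ?jV //.
  by rewrite spec_sym -iv.
- by rewrite jv hz ?in_setD1 ?iv ?iV // -jv.
- by rewrite rp ?in_setD1 ?iv ?jv ?iV ?jV.
Qed.

(** The column of ones comes last, so that column [k] sits in place [k] of the row in memory.
    Columns outside [K] are zero, which keeps the width fixed. *)
Definition lift_mx K : 'M[R]_(n, n.+1) :=
  \matrix_(i, j) if unlift ord_max j is Some k then (k \in K)%:R * dst i k else 1.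

Definition mask_rows m (S : {set 'I_n}) (X : 'M[R]_(n, m)) : 'M[R]_(n, m) :=
  \matrix_(i, j) ((i \in S)%:R * X i j).

(** Expanding the squared distance as |p_i|^2 + |p_k|^2 - 2 p_i.p_k gives two outer products and a
    product through dimension [d]. The column of ones is absorbed by the first outer product, so the
    rank is at most 1 + 1 + [d]. *)
Lemma lift_mx_rank V K S : realizable V -> K \subset V -> clique spec K ->
  S \subset K -> (\rank (mask_rows S (lift_mx K)) <= d.+2)%N.
Proof.
move=> [p rp] KV cK SK.
pose one (j : 'I_n.+1) : R := if unlift ord_max j is Some k then (k \in K)%:R else 0.
pose q i : R := sqnorm2 (p i).
pose A1 : 'cV[R]_n := \col_i (i \in S)%:R.
pose B1 : 'rV[R]_n.+1 :=
  \row_j if unlift ord_max j is Some k then (k \in K)%:R * q k else 1.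
pose A2 : 'cV[R]_n := \col_i ((i \in S)%:R * q i).
pose B2 : 'rV[R]_n.+1 := \row_j if unlift ord_max j is Some k then (k \in K)%:R else 0.
pose A3 : 'M[R]_(n, d) := \matrix_(i, c) ((i \in S)%:R * p i 0 c).
pose B3 : 'M[R]_(d, n.+1) := \matrix_(c, j)
  if unlift ord_max j is Some k then -2 * (k \in K)%:R * p k 0 c else 0.
suff -> : mask_rows S (lift_mx K) = A1 *m B1 + A2 *m B2 + A3 *m B3.
  apply: leq_trans (mxrank_add _ _) _; rewrite -(add2n d); apply: leq_add.
    apply: leq_trans (mxrank_add _ _) _; rewrite -[2%N]/(1 + 1)%N.
    by apply: leq_add; apply: leq_trans (mxrankM_maxr _ _) (rank_leq_row _).
  by apply: leq_trans (mxrankM_maxr _ _) (rank_leq_row _).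
apply/matrixP => i j; rewrite !mxE !big_ord1 !mxE.
under eq_bigr => c _ do rewrite !mxE.
case: unliftP => [k|] _; last first.
  by rewrite big1 => [|c _]; rewrite ?mulr0 // !addr0.
have [iS|iS] := boolP (i \in S); last first.
  by rewrite big1 => [|c _]; rewrite !mul0r // !addr0.
have [kK|kK] := boolP (k \in K); last first.
  by rewrite big1 => [|c _]; rewrite ?(mul0r, mulr0, addr0).
have iK := subsetP SK _ iS.
rewrite !mul1r mulr1 -rp ?(subsetP KV) ?cK // /q /sqnorm2 -!big_split /=.
by apply: eq_bigr => c _; rewrite !mxE; ring.
Qed.
End Realizations.

(** * Gaussian elimination *)

Section GaussianElimination.
Variables (F : fieldType) (n m : nat).
Variables (S : {set 'I_n}) (X : 'M[F]_(n, m)) (Y : 'cV[F]_n).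
Local Open Scope ring_scope.
Hypothesis X_supp : forall i k, i \notin S -> X i k = 0.

(* [B] is the set of rows that have been used as pivots so far, [c] the number
   of those among them that were nonzero, and [Y] an additional column that
   takes part in the row operations but is not searched for pivots. *)
Definition elim_inv (B : {set 'I_n}) (A : 'M[F]_(n, m)) (E : 'cV[F]_n) (c : nat) :=
  [/\ forall i, exists l, [/\ forall b, l b != 0 -> (b \in B) && (b \in S),
        forall k, A i k = X i k - \sum_b l b * X b k
      & E i 0 = Y i 0 - \sum_b l b * Y b 0],
      forall l, (forall k, \sum_i l i * X i k = 0) ->
        forall k, \sum_i l i * A i k = 0,
      forall b k, b \in B -> A b k = 0
    & (\rank A + c)%N = \rank X].

Lemma sum_deltal v (G : 'I_n -> F) : \sum_i (i == v)%:R * G i = G v.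
Proof.
under eq_bigr => i _ do rewrite mulr_natl mulrb.
by rewrite -big_mkcond big_pred1_eq.
Qed.

Lemma elim_inv0 : elim_inv set0 X Y 0.
Proof.
split=> [i|//|b k|]; rewrite ?inE ?addn0 //.
by exists (fun=> 0); split=> [b|k|]; rewrite ?eqxx // big1 ?subr0 // => b _; rewrite mul0r.
Qed.

Lemma elim_inv_zero B A E c b : elim_inv B A E c -> row b A = 0 ->
  elim_inv (b |: B) A E c.
Proof.
case=> h1 h2 h3 h4 /rowP b0; split=> // [i|b' k].
  have [l [ls lA lE]] := h1 i; exists l; split=> // b' /ls /andP[b'B ->].
  by rewrite !inE b'B orbT.
by rewrite !inE => /predU1P[->|/h3//]; have := b0 k; rewrite !mxE.
Qed.

(** The two matrices differ by an outer product, so the rank drops by at most one; it does drop,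
    because column [j] is cleared everywhere while row [b] of [A] is nonzero there. *)
Lemma elim_rank (A : 'M[F]_(n, m)) b j : A b j != 0 ->
  \rank A = (\rank (\matrix_(i, k) (A i k - A i j / A b j * A b k))).+1.
Proof.
move=> Abj; set A' := \matrix_(i, k) _; apply/eqP; rewrite eqn_leq; apply/andP; split.
  have -> : A = A' + (\col_i (A i j / A b j)) *m row b A.
    by apply/matrixP => i k; rewrite !mxE big_ord1 !mxE subrK.
  apply: leq_trans (mxrank_add _ _) _; rewrite -[(\rank A').+1]addn1 leq_add2l.
  by apply: leq_trans (mxrankM_maxr _ _) (rank_leq_row _).
apply: rank_ltmx; apply/andP; split.
  apply/row_subP => i.
  have -> : row i A' = row i A - (A i j / A b j) *: row b A.
    by apply/rowP => k; rewrite !mxE.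
  by rewrite addmx_sub ?eqmx_opp ?scalemx_sub ?row_sub.
apply/negP => /(submx_trans (row_sub b A)) /submxP[w /rowP/(_ j)].
rewrite !mxE big1 => [/eqP|i _]; first by rewrite (negbTE Abj).
by rewrite !mxE divfK // subrr mulr0.
Qed.

Lemma elim_inv_pivot B A E c b j (A' : 'M[F]_(n, m)) (E' : 'cV[F]_n) : elim_inv B A E c -> A b j != 0 ->
  (forall i k, A' i k = A i k - A i j / A b j * A b k) ->
  (forall i, E' i 0 = E i 0 - A i j / A b j * E b 0) ->
  elim_inv (b |: B) A' E' c.+1.
Proof.
case=> h1 h2 h3 h4 Abj hA' hE'; split=> [i|l hl k|b' k|].
- have [l [ls lA lE]] := h1 i; have [l' [ls' lA' lE']] := h1 b.
  set f := A i j / A b j.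
  (* A zero row of [X] stays zero: the relation with the single coefficient 1 at [b] is preserved by
     the row operations. *)
  have bS : b \in S.
    apply: contraR Abj => bS.
    rewrite -(sum_deltal b (fun i => A i j)) h2 ?eqxx // => k.
    by rewrite sum_deltal X_supp.
  (* The pivot row is itself [X b] minus its combination [l']; subtracting [f] times it changes the
     coefficients by [f] times that difference. *)
  exists (fun b' => l b' + f * ((b' == b)%:R - l' b')); split=> [b'|k|].
  + rewrite !inE; case: (eqVneq b' b) => [->|_] /=; first by rewrite bS.
    have [l0|/ls //] := eqVneq (l b') 0; have [l'0|/ls' //] := eqVneq (l' b') 0.
    by rewrite l0 l'0 subrr mulr0 addr0 eqxx.
  + rewrite hA' -/f lA lA'.
    under [in RHS]eq_bigr => b' _ do rewrite mulrDl -mulrA mulrBl.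
    rewrite big_split /= -mulr_sumr sumrB.
    by rewrite sum_deltal; ring.
  + rewrite hE' -/f lE lE'.
    under [in RHS]eq_bigr => b' _ do rewrite mulrDl -mulrA mulrBl.
    rewrite big_split /= -mulr_sumr sumrB.
    by rewrite sum_deltal; ring.
- under eq_bigr => i _ do rewrite hA' mulrBr !mulrA.
  by rewrite sumrB -!mulr_suml !(h2 _ hl) !mul0r subr0.
- rewrite !inE hA' => /predU1P[->|b'B]; first by rewrite divff // mul1r subrr.
  by rewrite !(h3 _ _ b'B) !mul0r subrr.
- rewrite -h4 (elim_rank Abj) addnS addSn; congr (\rank _ + _).+1.
  by apply/matrixP => i k; rewrite mxE hA'.
Qed.

(** Only row [v] of [A] can still be nonzero, which leaves the rank of [X] uncertain by one. If
    [X v] were a combination of the other rows, the corresponding relation would persist in [A] and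
    read there that row [v] is zero. *)
Lemma elim_inv_final v A E c : v \in S -> elim_inv [set~ v] A E c ->
  (c <= \rank X <= c.+1)%N /\
  if row v A == 0 then exists l, [/\ forall b, l b != 0 -> (b != v) && (b \in S),
        forall k, X v k = \sum_b l b * X b k
      & E v 0 = Y v 0 - \sum_b l b * Y b 0]
  else ~ exists2 l, l v = 0 & forall k, X v k = \sum_b l b * X b k.
Proof.
move=> vS [h1 h2 h3 h4]; split.
  rewrite -h4 leq_addl -add1n leq_add2r /=.
  have -> : A = \col_i (i == v)%:R *m row v A.
    apply/matrixP => i k; rewrite !mxE big_ord1 !mxE.
    by have [->|iv] := eqVneq i v; rewrite ?mul1r // mul0r h3 // !inE.
  by apply: leq_trans (mxrankM_maxr _ _) (rank_leq_row _).
case: eqP => [/rowP A0|A0].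
  have [l [ls lA lE]] := h1 v; exists l; split=> // [b /ls|k].
    by rewrite !inE.
  by apply/eqP; rewrite -subr_eq0 -lA; have := A0 k; rewrite !mxE => ->.
case=> l lv hl; apply: A0; apply/rowP => k; rewrite !mxE.
have : \sum_i ((i == v)%:R - l i) * A i k = 0.
  apply: (h2 (fun i => _)) => k'.
  under eq_bigr => i _ do rewrite mulrBl.
  by rewrite sumrB sum_deltal hl subrr.
under eq_bigr => i _ do rewrite mulrBl.
rewrite sumrB sum_deltal [X in _ - X]big1 ?subr0 // => i _.
by have [->|iv] := eqVneq i v; [rewrite lv mul0r|rewrite h3 ?mulr0 // !inE].
Qed.

Lemma row_span_comb (Z : {set 'I_n}) v : (row v X <= row_span X Z)%MS ->
  exists2 l : 'I_n -> F, forall b, l b != 0 -> b \in Z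
    & forall k, X v k = \sum_b l b * X b k.
Proof.
case/sub_sumsmxP => u hu.
have [l hl] : exists l : 'I_n -> F, forall b, u b *m <<row b X>>%MS = l b *: row b X.
  apply: (fin_all_exists (P := fun b a => u b *m <<row b X>>%MS = a *: row b X)) => b.
  apply/sub_rVP.
  by rewrite (submx_trans (submxMl _ _)) // genmxE.
exists (fun b => if b \in Z then l b else 0) => [b|k].
  by case: ifP => //; rewrite eqxx.
move/rowP/(_ k): hu; rewrite mxE summxE => ->.
rewrite big_mkcond; apply: eq_bigr => b _.
by case: ifP => _; rewrite ?mul0r // hl !mxE.
Qed.
End GaussianElimination.

(** * The program *)

(* Every scalar variable and every loop counter is cell 0 of an array of its
   own, so that arrays are the granularity of all frame conditions.
   Integer arrays: 2 [V], the vertices that are left; 3 the candidates for the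
   clique; 4 the clique [K]; 5 the status; 6 whether a vertex was deleted in
   this round; 7 whether the current vertex is deletable; 8 the number of
   pivots; 9 the pivot column plus 1, or 0; 10 and 11 the best candidate and
   its degree; 12 the current degree; 13 whether the reduced row is 0; 14 and
   15 the number and the list of the vertices of [V]; 16 a copy of array 1;
   20, ..., 28 loop counters.
   Real arrays: 1 the work matrix, with n + 1 columns; 2 and 6 the pivot row
   and its additional entry; 3 a copy of array 0; 4 the current factor; 5 the
   additional column. *)
Local Notation "'var' a" := (ILoad a (ICst 0)) (at level 8, a at level 8).
Definition maskE a e := ILe (ICst 1) (ILoad a e).
Definition cellE i j := IAdd (IMul i szE) j.
Definition specE i j := ILe (ICst 1) (ILoad 1 (cellE i j)).
Definition wcellE i k := IAdd (IMul i (IAdd szE (ICst 1))) k.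
Definition neqE i j := BNot (BAnd (ILe i j) (ILe j i)).
Definition rneq0E x := BNot (BAnd (RLe x (RCast (ICst 0))) (RLe (RCast (ICst 0)) x)).
Definition incr a := CIStore a (ICst 0) (IAdd (var a) (ICst 1)).
Definition assign a e := CIStore a (ICst 0) e.
Definition block := foldr CSeq CSkip.

(** The row is copied because [reduce_rows] clears row [b] too while still subtracting it from later
    rows. The pivot found is the last nonzero column. *)
Definition pivot_row (b : iexp) :=
  block [:: assign 9 (ICst 0);
    CFor 28 1 (block [:: CRStore 2 (var 28) (RLoad 1 (wcellE b (var 28)));
      CIf (rneq0E (RLoad 2 (var 28))) (assign 9 (IAdd (var 28) (ICst 1))) CSkip]);
    CRStore 6 (ICst 0) (RLoad 5 b)].

Definition pivotE := ISub (var 9) (ICst 1).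

(** The factor is stored first, as the inner loop overwrites the entry in the pivot column from
    which it is computed. *)
Definition reduce_rows :=
  CFor 27 0 (block [::
    CRStore 4 (ICst 0) (RDiv (RLoad 1 (wcellE (var 27) pivotE)) (RLoad 2 pivotE));
    CRStore 5 (var 27)
      (RSub (RLoad 5 (var 27)) (RMul (RLoad 4 (ICst 0)) (RLoad 6 (ICst 0))));
    CFor 28 1 (CRStore 1 (wcellE (var 27) (var 28))
      (RSub (RLoad 1 (wcellE (var 27) (var 28)))
         (RMul (RLoad 4 (ICst 0)) (RLoad 2 (var 28)))))]).

Definition eliminate (b : iexp) :=
  block [:: pivot_row b;
    CIf (ILe (ICst 1) (var 9)) (block [:: incr 8; reduce_rows]) CSkip].

Section Elimination.
Variables (R : realType) (n : nat).
Implicit Types s : state R.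
Local Open Scope ring_scope.

Definition work_mx s : 'M[R]_(n, n.+1) :=
  \matrix_(i, k) rmem s 1 (i * (n + 1) + k)%N.
Definition work_col s : 'cV[R]_n := \col_i rmem s 5 i.

Lemma cell_inj w i i' k k' : (k < w)%N -> (k' < w)%N ->
  (i * w + k == i' * w + k')%N = (i == i') && (k == k').
Proof.
move=> kw kw'; apply/idP/idP => [/eqP h|/andP[/eqP-> /eqP->//]].
have w0 : (0 < w)%N by apply: leq_ltn_trans kw.
have := congr1 (modn^~ w) h; rewrite !modnMDl !modn_small // => ->.
have := congr1 (divn^~ w) h; rewrite !divnMDl // !divn_small // !addn0 => ->.
by rewrite !eqxx.
Qed.

Lemma beval_rneq0 s x : beval s (rneq0E x) = (reval s x != 0).
Proof. by rewrite /= eq_le. Qed.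

Lemma run_block c l s : run (block (c :: l)) s = run (block l) (run c s).
Proof. by []. Qed.

Lemma run_block0 s : run (block [::]) s = s.
Proof. by []. Qed.

Lemma pivot_row_spec s (i : 'I_n) : imem s 0 1 = n -> imem s 26 0 = i ->
  let s' := run (pivot_row (var 26)) s in
  [/\ forall k : 'I_n.+1, rmem s' 2 k = work_mx s i k,
      rmem s' 6 0 = work_col s i 0
    & imem s' 9 0 = 0%N /\ row i (work_mx s) = 0 \/
      exists2 j : 'I_n.+1, imem s' 9 0 = j.+1 & work_mx s i j != 0].
Proof.
move=> hn hb s'; rewrite /s' /pivot_row !run_block run_block0.
set s0 := run (assign _ _) s.
set c := CFor _ _ _.
pose Inv K s1 := (forall k : 'I_n.+1, (k < K)%N -> rmem s1 2 k = work_mx s i k) /\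
  ((imem s1 9 0 = 0%N /\ forall k : 'I_n.+1, (k < K)%N -> work_mx s i k = 0) \/
      exists2 j : 'I_n.+1, imem s1 9 0 = j.+1 & work_mx s i j != 0).

have : Inv (n + 1)%N (run c s0).
  apply: run_for => //.
    by split=> [k|]; [rewrite ltn0|left; split=> [|k]; [exact: erefl|rewrite ltn0]].
  move=> k s1 kn ag [h1 h2]; rewrite !run_block run_block0.
  rewrite /run -/run beval_rneq0 /= /upd /= eqxx.
  rewrite (etrans (ag.1 26 0 isT) hb) (etrans (ag.1 0%N 1%N isT) hn) (ag.2 1%N _ isT).
  have kn' : (k < n.+1)%N by move: kn; rewrite addn1.
  have -> : rmem s0 1 (i * (n + 1) + k) = work_mx s i (Ordinal kn') by rewrite mxE.
  set x := work_mx s i _.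
  have hx (k' : 'I_n.+1) : k' = k :> nat -> work_mx s i k' = x.
    by move=> e; congr (work_mx s i _); apply: val_inj.
  have tmp s2 : (forall k', rmem s2 2 k' = if k' == k then x else rmem s1 2 k') ->
     forall k' : 'I_n.+1, (k' < k.+1)%N -> rmem s2 2 k' = work_mx s i k'.
    move=> e k'; rewrite e ltnS leq_eqVlt; case: eqVneq => [/hx->//|_] /= lt.
    exact: h1.
  case: ifP => [x0|/negbFE/eqP x0].
    split; first exact: tmp.
    by right; exists (Ordinal kn') => //=; rewrite addn1.
  split; first exact: tmp.
  case: h2 => [[p0 z]|ex]; [left|by right].
  split=> // k'; rewrite ltnS leq_eqVlt => /orP[/eqP/hx->//|]; exact: z.
have : rmem (run c s0) 5 i = work_col s i 0.
  by rewrite (agree_run c s0).2 // mxE.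
have : imem (run c s0) 26 0 = i by rewrite (agree_run c s0).1.
move: (run c s0) => s1 h26 h5 [h1 h2].
split=> /= [k||].
- by rewrite /upd /= h1 // addn1.
- by rewrite /upd /= h26.
- case: h2 => [[p0 z]|ex]; [left|by right].
  split=> //; apply/rowP => k; rewrite mxE [RHS]mxE z //.
  by rewrite addn1.
Qed.

Lemma reduce_rows_spec s (j : 'I_n.+1) (x : 'rV[R]_n.+1) y :
  imem s 0 1 = n -> imem s 9 0 = j.+1 -> (forall k : 'I_n.+1, rmem s 2 k = x 0 k) ->
  rmem s 6 0 = y ->
  let s' := run reduce_rows s in
  (forall i k, work_mx s' i k =
     work_mx s i k - work_mx s i j / x 0 j * x 0 k) /\
  (forall i, work_col s' i 0 = work_col s i 0 - work_mx s i j / x 0 j * y).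
Proof.
move=> hn hj hx hy s'.
pose f i := work_mx s i j / x 0 j.
pose Inv (I : nat) s1 :=
  (forall i k, work_mx s1 i k =
     if (i < I)%N then work_mx s i k - f i * x 0 k else work_mx s i k) /\
  (forall i, work_col s1 i 0 =
     if (i < I)%N then work_col s i 0 - f i * y else work_col s i 0).
suff : Inv (n + 0)%N s'.
  by case=> h1 h2; split=> i *; rewrite ?h1 ?h2 addn0 ltn_ord.
rewrite /s' /reduce_rows; apply: run_for => //.
  move=> i s1; rewrite addn0 => iN ag [h1 h2]; rewrite !run_block run_block0.
  pose io := Ordinal iN.
  set s2 := run (CRStore 4 _ _) _.
  have e4 : rmem s2 4 0 = f io.
    rewrite /s2 /= /upd /=.
    rewrite (etrans (ag.1 0%N 1%N isT) hn) (etrans (ag.1 9 0%N isT) hj) subn1 /=.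
    rewrite (ag.2 2 _ isT) hx; have := h1 io j; rewrite ltnn mxE => ->.
    by [].
  have [i2 n2 r5 r6] : [/\ imem s2 27 0 = i, imem s2 0 1 = n,
      forall k, rmem s2 5 k = rmem s1 5 k & rmem s2 6 0 = y].
    split=> //; first exact: etrans (ag.1 0%N 1%N isT) hn.
    exact: etrans (ag.2 6 0%N isT) hy.
  have [x2 w2] : (forall k : 'I_n.+1, rmem s2 2 k = x 0 k) /\
      forall i' k, work_mx s2 i' k = work_mx s1 i' k.
    by split=> [k|i' k]; [exact: etrans (ag.2 2 _ isT) (hx k)|rewrite !mxE].
  clearbody s2.
  set s3 := run (CRStore 5 _ _) _.
  have e5 k : rmem s3 5 k = if k == i then work_col s io 0 - f io * y else rmem s1 5 k.
    rewrite /s3 /= /upd /= i2 r5 e4 r6; case: ifP => // _.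
    by have := h2 io; rewrite mxE ltnn => ->.
  have e3 : [/\ imem s3 0 1 = n, imem s3 27 0 = i, rmem s3 4 0 = f io
      & forall k : 'I_n.+1, rmem s3 2 k = x 0 k] by split.
  have w3 i' k : work_mx s3 i' k = work_mx s1 i' k by rewrite -w2 !mxE.
  clearbody s3; case: e3 => n3 i3 f3 x3.
  set c := CFor _ _ _.
  pose Inv2 (K : nat) s4 := forall i' k, work_mx s4 i' k =
    if (i' == io) && (k < K)%N then work_mx s i' k - f i' * x 0 k
    else work_mx s1 i' k.
  have : Inv2 (n + 1)%N (run c s3).
    apply: run_for => // [i' k|k s4 kn ag2 ih i' k']; first by rewrite andbF w3.
    have kn' : (k < n.+1)%N by move: kn; rewrite addn1.
    pose ko := Ordinal kn'.
    rewrite /= mxE /= /upd /= (etrans (ag2.1 0%N 1%N isT) n3) (etrans (ag2.1 27 0%N isT) i3).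
    rewrite cell_inj ?[(n + 1)%N]addn1 // (etrans (ag2.2 4 0%N isT) f3).
    rewrite (etrans (ag2.2 2 _ isT) (x3 ko)).
    have := ih i' k'; have := ih io ko; rewrite !mxE /= eqxx ltnn.
    rewrite ltnS [(k' <= k)%N]leq_eqVlt -val_eqE /= addn1.
    case: (eqVneq (i' : nat) i) => [ei|_] /= hk.
      have -> : i' = io by apply: val_inj.
      case: (eqVneq (k' : nat) k) => [ek|_] //= _.
      have -> : k' = ko by apply: val_inj.
      by rewrite hk; have := h1 io ko; rewrite !mxE ltnn /= addn1 => ->.
    by [].
  have : forall k, rmem (run c s3) 5 k = rmem s3 5 k.
    by move=> k; rewrite (agree_run c s3).2.
  move: (run c s3) => s4 e45 ih; split=> [i' k|i'].
    rewrite ih [(k < _)%N](_ : _ = true) ?andbT; last by rewrite addn1 ltn_ord.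
    rewrite h1 [(i' < i.+1)%N]ltnS [(i' <= i)%N]leq_eqVlt -val_eqE /=.
    by case: (eqVneq (i' : nat) i).
  rewrite mxE e45 e5 ltnS leq_eqVlt.
  case: (eqVneq (i' : nat) i) => [ei|_] /=.
    by have -> : i' = io by apply: val_inj.
  by rewrite -h2 mxE.
Qed.
End Elimination.

(** * Testing whether a clique vertex is redundant for one neighbour *)

Definition load_rows :=
  CFor 27 0 (
    CIf (BAnd (maskE 4 (var 27)) (specE (var 25) (var 27)))
      (block [::
        CRStore 5 (var 27) (RLoad 0 (cellE (var 25) (var 27)));
        CFor 28 1 (CIf (ILe szE (var 28))
          (CRStore 1 (wcellE (var 27) (var 28)) (RCast (ICst 1)))
          (CIf (maskE 4 (var 28))
             (CRStore 1 (wcellE (var 27) (var 28)) (RLoad 0 (cellE (var 27) (var 28))))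
             (CRStore 1 (wcellE (var 27) (var 28)) (RCast (ICst 0)))))])
      (block [::
        CRStore 5 (var 27) (RCast (ICst 0));
        CFor 28 1 (CRStore 1 (wcellE (var 27) (var 28)) (RCast (ICst 0)))])).

Definition eliminate_all :=
  block [:: load_rows; assign 8 (ICst 0);
    CFor 26 0 (CIf (neqE (var 26) (var 24)) (eliminate (var 26)) CSkip)].

(** Counters 24 and 25 hold [v] and [u]. Row [v] is never a pivot: its remainder vanishes exactly
    when it depends on the other rows, and its entry in array 5 is then the discrepancy of the
    distance between [u] and [v]. Independence only clears flag 7; a discrepancy or too many pivots
    settles the answer no. *)
Definition test_pair :=
  block [:: eliminate_all; assign 13 (ICst 1);
    CFor 28 1 (CIf (rneq0E (RLoad 1 (wcellE (var 24) (var 28))))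
                 (assign 13 (ICst 0)) CSkip);
    CIf (ILe (ICst 1) (var 13))
      (CIf (rneq0E (RLoad 5 (var 24))) (assign 5 (ICst 2)) CSkip)
      (assign 7 (ICst 0));
    CIf (ILe (var 8) (IAdd (ILoad 0 (ICst 2)) (ICst 2))) CSkip (assign 5 (ICst 2))].

Section TestPair.
Variables (R : realType) (n d : nat) (M : 'M[option R]_n).
Hypothesis M_partial : partial_matrix M.
Implicit Types (s : state R) (K V : {set 'I_n}).
Local Open Scope ring_scope.

Notation inp s := (outputs_instance s d M).
Definition stores s a K := forall i : 'I_n, imem s a i = (i \in K).

Lemma inp_agree c s s1 : agree c s s1 -> 0%N \notin iwrites c -> 1%N \notin iwrites c ->
  0%N \notin rwrites c -> inp s -> inp s1.
Proof.
move=> ag w0 w1 w2 [h1 h2 h3 h4 h5].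
by split=> *; rewrite ?(ag.1 _ _ w0) ?(ag.1 _ _ w1) ?(ag.2 _ _ w2).
Qed.

Lemma stores_agree c s s1 a K : agree c s s1 -> a \notin iwrites c -> stores s a K ->
  stores s1 a K.
Proof. by move=> ag w h i; rewrite (ag.1 _ _ w). Qed.

Lemma beval_spec s x y (i j : 'I_n) : inp s -> ieval s x = i -> ieval s y = j ->
  beval s (specE x y) = spec M i j.
Proof.
case=> _ hn _ hs _ ex ey; rewrite /= ex ey hn hs /spec.
by case: (isSome _).
Qed.

Lemma beval_stores s a x K (i : 'I_n) : stores s a K -> ieval s x = i ->
  beval s (maskE a x) = (i \in K).
Proof. by move=> h ex; rewrite /= ex h; case: (i \in K). Qed.

Lemma reval_dst s x y (i j : 'I_n) : inp s -> ieval s x = i -> ieval s y = j ->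
  reval s (RLoad 0 (cellE x y)) = dst M i j.
Proof. by case=> _ hn _ _ hd ex ey; rewrite /= ex ey hn hd. Qed.

Lemma run_if b c1 c2 s : run (CIf b c1 c2) s = if beval s b then run c1 s else run c2 s.
Proof. by []. Qed.

Lemma beval_and b1 b2 s : beval s (BAnd b1 b2) = beval s b1 && beval s b2.
Proof. by []. Qed.

Definition nbrs K u : {set 'I_n} := [set b in K | spec M u b].

Lemma load_rows_spec s K (u : 'I_n) : inp s -> stores s 4 K -> imem s 25 0 = u ->
  let s' := run load_rows s in
  work_mx n s' = mask_rows (nbrs K u) (lift_mx M K) /\
  forall i, work_col n s' i 0 = (i \in nbrs K u)%:R * dst M u i.
Proof.
move=> hi hK hu s'.
set X := mask_rows _ _.
pose Inv (I : nat) s1 := forall i : 'I_n, (i < I)%N ->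
  (forall k, work_mx n s1 i k = X i k) /\
  work_col n s1 i 0 = (i \in nbrs K u)%:R * dst M u i.
suff H : Inv (n + 0)%N s'.
  by split=> [|i]; [apply/matrixP => i k|]; case: (H i) => //; rewrite addn0.
have hn : imem s 0 1 = n by case: hi.
apply: run_for => // i s1; rewrite addn0 => iN ag ih.
pose io := Ordinal iN.
set s2 := seti s1 27 0 i.
have hi2 : inp s2 by apply: (inp_agree ag).
have hK2 : stores s2 4 K by apply: (stores_agree ag).
have hu2 : imem s2 25 0 = u by apply: etrans (ag.1 25 0%N isT) hu.
have i2 : imem s2 27 0 = io by [].
have ih2 : Inv i s2 by [].
clearbody s2; move: ih => _; clear ag.
rewrite run_if beval_and.
rewrite (beval_stores (x := var 27) hK2 i2) (beval_spec (x := var 25) (y := var 27) hi2 hu2 i2).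
have -> : (io \in K) && spec M u io = (io \in nbrs K u) by rewrite inE.
have main c3 e5 : 28%N != 0%N -> wf c3 -> iwrites c3 = [::] -> 0%N \notin rwrites c3 -> 5%N \notin rwrites c3 ->
    reval s2 e5 = (io \in nbrs K u)%:R * dst M u io ->
    (forall s3 (k : 'I_n.+1), inp s3 -> stores s3 4 K -> imem s3 25 0 = u ->
       imem s3 27 0 = io -> imem s3 28 0 = k ->
       run c3 s3 = setr s3 1 (io * (n + 1) + k)%N (X io k)) ->
    Inv i.+1 (run (block [:: CRStore 5 (var 27) e5; CFor 28 1 c3]) s2).
  move=> _ _ wi wr0 wr5 he hc; rewrite !run_block run_block0.
  set s3 := run (CRStore _ _ _) _.
  have e3 k : rmem s3 5 k = if k == i then (io \in nbrs K u)%:R * dst M u io else rmem s2 5 k.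
    by rewrite /s3 /run he /= /upd /= i2.
  have hi3 : inp s3 by apply: (inp_agree (agree_run _ s2)).
  have hK3 : stores s3 4 K by [].
  have [u3 i3] : imem s3 25 0 = u /\ imem s3 27 0 = io by [].
  have w3 : work_mx n s3 = work_mx n s2 by apply/matrixP => a b; rewrite !mxE.
  clearbody s3.
  have n3 : imem s3 0 1 = n by case: hi3.
  pose Inv2 (k : nat) s4 := forall (i' : 'I_n) (k' : 'I_n.+1),
    work_mx n s4 i' k' = if (i' == io) && (k' < k)%N then X i' k' else work_mx n s2 i' k'.
  have : Inv2 (n + 1)%N (run (CFor 28 1 c3) s3).
    apply: run_for => // [i' k'|k s4 kn ag ih i' k']; first by rewrite andbF w3.
    have kn' : (k < n.+1)%N by move: kn; rewrite addn1.
    pose ko := Ordinal kn'.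
    have wc : iwrites (CFor 28 1 c3) = [:: 28%N] by rewrite /= wi.
    rewrite (hc _ ko) //; first last.
    - by apply: etrans (ag.1 27%N 0%N _) i3; rewrite wc.
    - by apply: etrans (ag.1 25%N 0%N _) u3; rewrite wc.
    - by apply: (stores_agree ag); rewrite ?wc.
    - by apply: (inp_agree ag); rewrite ?wc //=.
    have := ih i' k'; rewrite !mxE /= /upd eqxx /= cell_inj ?[(n + 1)%N]addn1 //.
    rewrite ltnS [(k' <= k)%N]leq_eqVlt -val_eqE /=.
    case: (eqVneq (i' : nat) i) => [ei|_] //=.
    have -> : i' = io by apply: val_inj.
    case: (eqVneq (k' : nat) k) => [ek|_] //= _.
    by have -> : k' = ko by apply: val_inj.
  have : forall k, rmem (run (CFor 28 1 c3) s3) 5 k = rmem s3 5 k.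
    by move=> k; rewrite (agree_run _ s3).2.
  move: (run _ s3) => s4 e45 ih i' ii.
  have [ei|ni] := eqVneq i' io.
    rewrite ei mxE e45 e3 eqxx; split=> // k.
    by rewrite ih eqxx addn1 ltn_ord.
  have lt : (i' < i)%N by move: ii; rewrite ltnS leq_eqVlt -[i' == i :> nat]/(i' == io) (negbTE ni).
  have [h1 h2] := ih2 i' lt; split=> [k|].
    by rewrite ih (negbTE ni) h1.
  by rewrite mxE e45 e3 -[i' == i :> nat]/(i' == io) (negbTE ni) -h2 mxE.
case: ifP => iS; apply: main => //.
- by rewrite iS mul1r; apply: (reval_dst (x := var 25) (y := var 27) hi2 hu2 i2).
- move=> s3 k hi3 hK3 u3 i3 k3; rewrite !run_if.
  have n3 : imem s3 0 1 = n by case: hi3.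
  have -> : X io k = if unlift ord_max k is Some k' then (k' \in K)%:R * dst M io k' else 1.
    by rewrite !mxE iS mul1r.
  have -> : beval s3 (ILe szE (var 28)) = (n <= k)%N by rewrite /= n3 k3.
  case: unliftP => [k'|] ek.
    have ek' : k = k' :> nat by rewrite ek lift_max.
    rewrite ek' in k3 *.
    rewrite (beval_stores (x := var 28) hK3 k3) ifF; last by rewrite leqNgt ltn_ord.
    case: ifP => _.
      by rewrite /run (reval_dst (x := var 27) (y := var 28) hi3 i3 k3) /= i3 n3 k3 mul1r.
    by rewrite /= i3 n3 k3 mul0r.
  by rewrite ek leqnn /= i3 n3 k3 ek.
- by rewrite iS mul0r.
- move=> s3 k hi3 hK3 u3 i3 k3.
  have n3 : imem s3 0 1 = n by case: hi3.
  by rewrite /= i3 n3 k3 mxE iS mul0r.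
Qed.

Lemma eliminate_spec (S B : {set 'I_n}) (X : 'M[R]_(n, n.+1)) Y s (i : 'I_n) :
  (forall j k, j \notin S -> X j k = 0) ->
  imem s 0 1 = n -> imem s 26 0 = i ->
  elim_inv S X Y B (work_mx n s) (work_col n s) (imem s 8 0) ->
  let s' := run (eliminate (var 26)) s in
  elim_inv S X Y (i |: B) (work_mx n s') (work_col n s') (imem s' 8 0).
Proof.
move=> hX hn hi inv s'; rewrite /s' /eliminate 2!run_block run_block0 run_if.
have [h2 h6 h9] := pivot_row_spec hn hi.
have ag := agree_run (pivot_row (var 26)) s.
move: (run (pivot_row _) s) ag h2 h6 h9 => s1 ag h2 h6 h9.
have n1 : imem s1 0 1 = n by rewrite (ag.1 0%N 1%N isT).
have e8 : imem s1 8 0 = imem s 8 0 by rewrite (ag.1 8%N 0%N isT).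
have wm : work_mx n s1 = work_mx n s.
  by apply/matrixP => a k; rewrite !mxE (ag.2 1%N _ isT).
have wc : work_col n s1 = work_col n s.
  by apply/matrixP => a k; rewrite !mxE (ag.2 5%N _ isT).
rewrite -e8 -wm -wc in inv h2 h6 h9.
case: h9 => [[p0 r0]|[j pj aj]].
  by rewrite ifF; [exact: (elim_inv_zero inv r0)|rewrite /beval /ieval p0].
have -> : beval s1 (ILe (ICst 1) (var 9)) by rewrite /beval /ieval pj.
rewrite !run_block run_block0; set s2 := run (incr 8) s1.
have h2' (k : 'I_n.+1) : rmem s2 2 k = (row i (work_mx n s1)) 0 k by rewrite mxE -h2.
have [] := @reduce_rows_spec _ _ s2 j _ _ n1 pj h2' h6.
have -> : work_mx n s2 = work_mx n s1 by [].
have -> : work_col n s2 = work_col n s1 by [].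
have ag2 := agree_run reduce_rows s2.
move: (run reduce_rows s2) ag2 => s3 ag2 hA hE.
have -> : imem s3 8 0 = (imem s1 8 0).+1.
  by rewrite (ag2.1 8%N 0%N isT) /= /upd /= addn1.
apply: (elim_inv_pivot hX inv aj) => [a k|a].
  by rewrite hA !mxE.
by rewrite hE !mxE.
Qed.

Lemma eliminate_all_spec s K (u v : 'I_n) : inp s -> stores s 4 K ->
  imem s 25 0 = u -> imem s 24 0 = v -> v \in nbrs K u ->
  let s' := run eliminate_all s in
  let Y := \col_i ((i \in nbrs K u)%:R * dst M u i) in
  elim_inv (nbrs K u) (mask_rows (nbrs K u) (lift_mx M K)) Y
    [set~ v] (work_mx n s') (work_col n s') (imem s' 8 0).
Proof.
move=> hi hK hu hv vS s' Y; rewrite /s' /eliminate_all 3!run_block run_block0.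
have [h1 h2] := load_rows_spec hi hK hu.
have ag := agree_run load_rows s.
set X := mask_rows _ _ in h1 *.
move: (run load_rows s) ag h1 h2 => s1 ag h1 h2.
have n1 : imem s1 0 1 = n by rewrite (ag.1 0%N 1%N isT); case: hi.
have v1 : imem s1 24 0 = v by rewrite (ag.1 24%N 0%N isT).
have hX i k : i \notin nbrs K u -> X i k = 0.
  by move=> iS; rewrite mxE (negbTE iS) mul0r.
pose Inv (I : nat) s2 := elim_inv (nbrs K u) X Y [set b : 'I_n | (b < I)%N && (b != v)]
  (work_mx n s2) (work_col n s2) (imem s2 8 0).
set s2 := run (assign 8 _) s1; set c := CFor _ _ _.
have : Inv (n + 0)%N (run c s2).
  apply: run_for => //.
    rewrite /Inv; have -> : work_mx n s2 = X by [].
    have -> : work_col n s2 = Y.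
      by apply/matrixP => i k; rewrite !ord1 -[work_col n s2]/(work_col n s1) h2 mxE.
    rewrite [imem _ _ _]/= (_ : [set b | _] = set0); last first.
      by apply/setP => b; rewrite !inE.
    exact: elim_inv0.
  move=> i s3; rewrite addn0 => iN ag3 inv; rewrite run_if.
  pose io := Ordinal iN.
  have -> : beval (seti s3 26 0 i) (neqE (var 26) (var 24)) = (io != v).
    rewrite /= /upd /= (etrans (ag3.1 24%N 0%N isT) v1) -eqn_leq.
    by rewrite -val_eqE.
  rewrite /Inv; have -> : [set b : 'I_n | (b < i.+1)%N && (b != v)] =
      if io != v then io |: [set b : 'I_n | (b < i)%N && (b != v)]
      else [set b : 'I_n | (b < i)%N && (b != v)].
    apply/setP => b.
    rewrite !inE ltnS leq_eqVlt -[b == i :> nat]/(b == io).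
    case: (eqVneq io v) => [ev|nv] /=; rewrite !inE ?ev.
      by case: (eqVneq b v); rewrite ?andbF ?orbF ?andbT //= andbF.
    by case: (eqVneq b io) => [->|_] //=; rewrite nv.
  case: ifP => _ //.
  apply: eliminate_spec => //.
  by apply: etrans (ag3.1 0%N 1%N isT) n1.
rewrite /Inv (_ : [set b | _] = [set~ v]) //.
by apply/setP => b; rewrite !inE addn0 ltn_ord.
Qed.

Definition bad_pair K u v :=
  (exists2 l, dependency M K u v l & dst M u v != \sum_b l b * dst M u b) \/
  (d.+2 < \rank (mask_rows (nbrs K u) (lift_mx M K)))%N.

(** The pivot count omits row [v]: a count above [d.+2] proves a rank above [d.+2], but a count
    within it bounds the rank only by [d.+3]. *)
Lemma test_pair_spec s K (u v : 'I_n) : inp s -> stores s 4 K ->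
  imem s 25 0 = u -> imem s 24 0 = v -> v \in nbrs K u ->
  let s' := run test_pair s in
  [/\ imem s' 5 0 = imem s 5 0 \/ imem s' 5 0 = 2%N /\ bad_pair K u v,
      imem s 5 0 = 2%N -> imem s' 5 0 = 2%N,
      imem s' 5 0 <> 2%N ->
        (\rank (mask_rows (nbrs K u) (lift_mx M K)) <= d.+3)%N
    & imem s' 7 0 = 0%N /\
        ~~ (row v (lift_mx M K) <= row_span (lift_mx M K) (nbrs K u :\ v))%MS \/
      imem s' 7 0 = imem s 7 0 /\ (imem s' 5 0 = 2%N \/
        exists2 l, dependency M K u v l & dst M u v = \sum_b l b * dst M u b)].
Proof.
move=> hi hK hu hv vS s'; rewrite /s' /test_pair 5!run_block run_block0.
have := eliminate_all_spec hi hK hu hv vS; cbv zeta.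
have ag := agree_run eliminate_all s.
move: (run eliminate_all s) ag => s1 ag.
set X := mask_rows _ _; set Y := \col_i _.
have hX i k : i \notin nbrs K u -> X i k = 0.
  by move=> iS; rewrite mxE (negbTE iS) mul0r.
have n1 : imem s1 0 1 = n by rewrite (ag.1 0%N 1%N isT); case: hi.
have d1 : imem s1 0 2 = d by rewrite (ag.1 0%N 2%N isT); case: hi.
have v1 : imem s1 24 0 = v by rewrite (ag.1 24%N 0%N isT).
have st1 : imem s1 5 0 = imem s 5 0 by rewrite (ag.1 5%N 0%N isT).
have ok1 : imem s1 7 0 = imem s 7 0 by rewrite (ag.1 7%N 0%N isT).
move/(elim_inv_final vS); set A := work_mx n s1; set E := work_col n s1.
case=> /andP[rk1 rk2] fin.
set s2 := run (assign 13 _) s1; set c := CFor _ _ _.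
pose Inv (k : nat) s3 := imem s3 13 0 = [forall k' : 'I_n.+1, (k' < k)%N ==> (A v k' == 0)].
have : Inv (n + 1)%N (run c s2).
  apply: run_for => //.
    rewrite /Inv; have -> : imem s2 13 0 = 1%N by [].
    by case: forallP => // -[].
  move=> k s3 kn ag3 inv; rewrite run_if beval_rneq0.
  have kn' : (k < n.+1)%N by move: kn; rewrite addn1.
  have -> : reval (seti s3 28 0 k) (RLoad 1 (wcellE (var 24) (var 28))) = A v (Ordinal kn').
    rewrite /= /upd /= (etrans (ag3.1 24%N 0%N isT) v1) (etrans (ag3.1 0%N 1%N isT) n1).
    by rewrite (ag3.2 1%N _ isT) mxE.
  case: ifP => [nz|/negbFE/eqP z].
    rewrite /Inv /= /upd /=; case: forallP => // /(_ (Ordinal kn')).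
    by rewrite /= ltnSn (negbTE nz).
  rewrite /Inv /= -[LHS]/(imem s3 13 0) inv; congr nat_of_bool.
  apply: eq_forallb => k'; rewrite ltnS [(k' <= k)%N]leq_eqVlt.
  case: (eqVneq (k' : nat) k) => [e|] //=.
  have -> : k' = Ordinal kn' by apply: val_inj.
  by rewrite z eqxx implybT.
have ag2 : agree c s2 (run c s2) := agree_run c s2.
move: (run c s2) ag2 => s3 ag3 z3.
have {z3} e13 : imem s3 13 0 = (row v A == 0).
  rewrite z3; congr nat_of_bool; apply/forallP/eqP => [h|h k].
    by apply/rowP => k; have := h k; rewrite addn1 ltn_ord !mxE => /eqP.
  by apply/implyP => _; move/rowP/(_ k): h; rewrite !mxE => ->.
have e8 : imem s3 8 0 = imem s1 8 0 by exact: (ag3.1 8%N 0%N isT).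
have e2 : imem s3 0 2 = d by exact: etrans (ag3.1 0%N 2%N isT) d1.
have v3 : imem s3 24 0 = v by exact: etrans (ag3.1 24%N 0%N isT) v1.
have st3 : imem s3 5 0 = imem s 5 0 by exact: etrans (ag3.1 5%N 0%N isT) st1.
have ok3 : imem s3 7 0 = imem s 7 0 by exact: etrans (ag3.1 7%N 0%N isT) ok1.
have E3 : rmem s3 5 v = E v 0 by rewrite (ag3.2 5%N _ isT) mxE.
clear ag3 ag.
rewrite !run_if beval_rneq0.
have -> : beval s3 (ILe (ICst 1) (var 13)) = (row v A == 0).
  by rewrite /= e13; case: (_ == _).
have -> : reval s3 (RLoad 5 (var 24)) = E v 0 by rewrite /= v3 E3.
set s4 := (if row v A == 0 then _ else _).
have -> : beval s4 (ILe (var 8) (IAdd (ILoad 0 (ICst 2)) (ICst 2))) = (imem s1 8 0 <= d.+2)%N.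
  rewrite -e8 -[d.+2]addn2 -e2 /s4.
  by case: ifP => _; [case: ifP => _|]; exact: erefl.
have p5 : row v A == 0 -> exists2 l, dependency M K u v l &
    E v 0 = dst M u v - \sum_b l b * dst M u b.
  move=> z; move: fin; rewrite z => -[l [ls lA lE]].
  have inS b : l b != 0 -> (b \in nbrs K u) by move=> /ls /andP[].
  have lX b k : l b * X b k = l b * lift_mx M K b k.
    have [->|/inS bS] := eqVneq (l b) 0; first by rewrite !mul0r.
    by rewrite mxE bS mul1r.
  exists l; last first.
    rewrite lE mxE vS mul1r; congr (_ - _); apply: eq_bigr => b _.
    have [->|/inS bS] := eqVneq (l b) 0; first by rewrite !mul0r.
    by rewrite mxE bS mul1r.
  split=> [b lb||k kK].
  - by have := inS b lb; rewrite inE => /andP[-> ->]; case/andP: (ls b lb) => ->.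
  - have := lA ord_max; rewrite mxE vS mul1r mxE unlift_none => ->.
    by apply: eq_bigr => b _; rewrite lX mxE unlift_none mulr1.
  - have := lA (lift ord_max k); rewrite mxE vS mul1r mxE liftK kK mul1r => ->.
    by apply: eq_bigr => b _; rewrite lX mxE liftK kK mul1r.
have p7 : row v A != 0 ->
    ~~ (row v (lift_mx M K) <= row_span (lift_mx M K) (nbrs K u :\ v))%MS.
  move=> nz; move: fin; rewrite (negbTE nz) => h.
  apply/negP => /row_span_comb[l ls hl]; apply: h; exists l.
    by apply/eqP; apply: contraT => /ls; rewrite !inE eqxx.
  move=> k; rewrite mxE vS mul1r hl; apply: eq_bigr => b _.
  have [->|/ls] := eqVneq (l b) 0; first by rewrite !mul0r.
  by rewrite in_setD1 => /andP[_ bS]; rewrite [in RHS]mxE bS mul1r.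
have bad5 : row v A == 0 -> E v 0 != 0 -> bad_pair K u v.
  by move=> /p5[l dl ->]; rewrite subr_eq0 => ne; left; exists l.
have badr : ~~ (imem s1 8 0 <= d.+2)%N -> bad_pair K u v.
  by rewrite -ltnNge => lt; right; apply: leq_trans lt rk1.
have good5 : row v A == 0 -> E v 0 == 0 ->
    exists2 l, dependency M K u v l & dst M u v = \sum_b l b * dst M u b.
  by move=> /p5[l dl ->]; rewrite subr_eq0 => /eqP e; exists l.
have rkd : (imem s1 8 0 <= d.+2)%N -> (\rank X <= d.+3)%N.
  by move=> le; apply: leq_trans rk2 _; rewrite ltnS.
rewrite /s4.
case: (boolP (row v A == 0)) => zA; [case: (boolP (E v 0 == 0)) => zE|];
  case: (boolP (imem s1 8 0 <= d.+2)%N) => rk.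
- split; [by left; rewrite -st3|by rewrite -st3|by move=> _; apply: rkd|].
  by right; split; [rewrite -ok3|right; apply: good5].
- split=> //; first by right; split; [|apply: badr].
  by right; split; [rewrite -ok3|left].
- split=> //; first by right; split; [|apply: bad5].
  by right; split; [rewrite -ok3|left].
- split=> //; first by right; split; [|apply: badr].
  by right; split; [rewrite -ok3|left].
- split; [by left; rewrite -st3|by rewrite -st3|by move=> _; apply: rkd|].
  by left; split=> //; apply: p7.
- split=> //; first by right; split; [|apply: badr].
  by left; split=> //; apply: p7.
Qed.
End TestPair.

(** * Greedy search for a clique *)

Definition count_degree :=
  block [:: assign 12 (ICst 0);
    CFor 23 0 (CIf (BAnd (maskE 3 (var 23)) (specE (var 22) (var 23))) (incr 12) CSkip)].

(** Each candidate counts itself as a neighbour, so best degree 0 signals that no candidate is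
    left. *)
Definition best_vertex :=
  block [:: assign 11 (ICst 0);
    CFor 22 0 (CIf (maskE 3 (var 22))
      (block [:: count_degree;
         CIf (ILe (IAdd (var 11) (ICst 1)) (var 12))
           (block [:: assign 11 (var 12); assign 10 (var 22)]) CSkip]) CSkip)].

Definition take_vertex :=
  block [:: CIStore 4 (var 10) (ICst 1); CIStore 3 (var 10) (ICst 0);
    CFor 23 0 (CIf (specE (var 10) (var 23)) CSkip (CIStore 3 (var 23) (ICst 0)))].

Definition grow_clique :=
  block [:: best_vertex; CIf (ILe (ICst 1) (var 11)) take_vertex CSkip].

Definition find_clique :=
  block [::
    CFor 22 0 (block [:: CIStore 3 (var 22) (ILoad 2 (var 22));
                         CIStore 4 (var 22) (ICst 0)]);
    CFor 21 0 grow_clique].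

Section FindClique.
Variables (R : realType) (n d : nat) (M : 'M[option R]_n).
Hypothesis M_partial : partial_matrix M.
Implicit Types (s : state R) (K V C : {set 'I_n}).

Notation inp s := (outputs_instance s d M).

Lemma inp_size s : inp s -> imem s 0 1 = n. Proof. by case. Qed.

Lemma count_degree_spec s C (i : 'I_n) : inp s -> stores s 3 C -> imem s 22 0 = i ->
  imem (run count_degree s) 12 0 = #|[set j in C | spec M i j]|.
Proof.
move=> hi hC h22; rewrite /count_degree 2!run_block run_block0.
set s1 := run (assign _ _) s; set c := CFor _ _ _.
pose Inv (k : nat) s2 := imem s2 12 0 = #|[set j in C | spec M i j && (j < k)]|.
have hi1 : inp s1 by apply: (inp_agree (agree_run _ s)).
have : Inv (n + 0) (run c s1).
  apply: run_for => //; first exact: inp_size hi.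
    rewrite /Inv (_ : [set j in C | _] = set0) ?cards0 //.
    by apply/setP => j; rewrite !inE ltn0 !andbF.
  move=> k s2; rewrite addn0 => kn ag ih.
  pose ko := Ordinal kn; set s3 := seti s2 23 0 k.
  have hi3 : inp s3 by apply: (inp_agree ag).
  have hC3 : stores s3 3 C by apply: (stores_agree ag).
  have i3 : ieval s3 (var 22) = i by apply: etrans (ag.1 22%N 0%N isT) h22.
  have k3 : ieval s3 (var 23) = ko by [].
  rewrite run_if beval_and (beval_stores hC3 k3) (beval_spec hi3 i3 k3).
  have -> : (ko \in C) && spec M i ko = (ko \in [set j in C | spec M i j]) by rewrite inE.
  rewrite /Inv (cardsD1 ko [set j in C | _ && (j < k.+1)]) !inE ltnSn andbT.
  have -> : [set j in C | spec M i j && (j < k.+1)] :\ ko = [set j in C | spec M i j && (j < k)].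
    apply/setP => j; rewrite !inE [j < k]ltn_neqAle ltnS -[j != k :> nat]/(j != ko).
    by case: (j != ko); rewrite ?andbF.
  case: ifP => _; last by rewrite -ih.
  by rewrite add1n -ih /= /upd /= addn1.
rewrite /Inv addn0 => ->; apply: eq_card => j; by rewrite !inE ltn_ord andbT.
Qed.

Lemma best_vertex_spec s C : inp s -> stores s 3 C ->
  let s' := run best_vertex s in
  imem s' 11 0 = 0 /\ C = set0 \/
  exists b : 'I_n, [/\ b \in C, 0 < imem s' 11 0, imem s' 10 0 = b
    & {in C, forall i, #|[set j in C | spec M i j]| <= #|[set j in C | spec M b j]|}].
Proof.
move=> hi hC s'; rewrite /s' /best_vertex 2!run_block run_block0.
set s1 := run (assign _ _) s; set c := CFor _ _ _.
pose deg i := #|[set j in C | spec M i j]|.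
have deg_gt0 i : i \in C -> 0 < deg i.
  by move=> iC; apply/card_gt0P; exists i; rewrite inE iC spec_refl.
pose Inv (k : nat) s2 := (imem s2 11 0 = 0 /\ forall i : 'I_n, i < k -> i \notin C) \/
  exists b : 'I_n, [/\ b \in C, imem s2 11 0 = deg b, imem s2 10 0 = b
    & forall i : 'I_n, i \in C -> i < k -> deg i <= deg b].
have : Inv (n + 0) (run c s1).
  apply: run_for => //; [exact: inp_size hi|by left|].
  move=> k s2; rewrite addn0 => kn ag ih.
  pose ko := Ordinal kn; set s3 := seti s2 22 0 k.
  have hi3 : inp s3 by apply: (inp_agree ag); rewrite ?(inp_agree (agree_run _ s)).
  have hC3 : stores s3 3 C by apply: (stores_agree ag).
  have k3 : ieval s3 (var 22) = ko by [].
  have ih3 : Inv k s3 by [].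
  have kS (i : 'I_n) : i < k.+1 -> i = ko \/ i < k.
    by rewrite ltnS leq_eqVlt => /orP[/eqP e|]; [left; apply: val_inj|right].
  clearbody s3; clear ih; rewrite run_if (beval_stores hC3 k3).
  case: ifP => kC; last first.
    case: ih3 => [[z h]|[b [bC e11 e10 bmax]]].
      by left; split=> // i /kS[->|/h//]; rewrite kC.
    right; exists b; split=> // i iC /kS[e|]; last exact: bmax.
    by rewrite e kC in iC.
  rewrite 2!run_block run_block0.
  have e12 := count_degree_spec hi3 hC3 k3.
  have ag3 := agree_run count_degree s3.
  move: (run count_degree s3) ag3 e12 => s4 ag4 e12.
  have e11 : imem s4 11 0 = imem s3 11 0 by exact: ag4.1.
  have e10 : imem s4 10 0 = imem s3 10 0 by exact: ag4.1.
  have k4 : imem s4 22 0 = k by rewrite ag4.1.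
  rewrite run_if.
  have -> : beval s4 (ILe (IAdd (var 11) (ICst 1)) (var 12)) = (imem s3 11 0 < deg ko).
    by rewrite /beval /ieval addn1 e11 e12.
  case: ifP => lt.
    right; exists ko; rewrite 2!run_block run_block0.
    have -> : imem (run (assign 10 (var 22)) (run (assign 11 (var 12)) s4)) 11 0 = deg ko.
      by exact: e12.
    have -> : imem (run (assign 10 (var 22)) (run (assign 11 (var 12)) s4)) 10 0 = ko.
      by rewrite [RHS]/= -k4.
    split=> // i iC /kS[->//|ik].
    case: ih3 => [[z h]|[b [bC e11' e10' bmax]]]; first by rewrite (negbTE (h i ik)) in iC.
    by apply: leq_trans (bmax i iC ik) _; rewrite -e11' ltnW.
  case: ih3 => [[z h]|[b [bC e11' e10' bmax]]].
    by rewrite z deg_gt0 in lt.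
  right; exists b; split=> //; rewrite ?[run CSkip s4]/= ?e11 ?e10 //.
  move=> i iC /kS[->|]; last exact: bmax.
  by rewrite -e11' leqNgt lt.
case=> [[z h]|[b [bC e11 e10 bmax]]].
  left; split=> //; apply/setP => i; rewrite inE; apply/negbTE/h.
  by rewrite addn0.
right; exists b; split=> //; first by rewrite e11 deg_gt0.
by move=> i iC; apply: bmax => //; rewrite addn0.
Qed.

Lemma take_vertex_spec s K C (b : 'I_n) : inp s -> stores s 3 C -> stores s 4 K ->
  imem s 10 0 = b ->
  let s' := run take_vertex s in
  stores s' 3 ([set j in C | spec M b j] :\ b) /\ stores s' 4 (b |: K).
Proof.
move=> hi hC hK hb s'; rewrite /s' /take_vertex 3!run_block run_block0.
set s1 := run (CIStore 3 _ _) _; set c := CFor _ _ _.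
have m4 : stores s1 4 (b |: K).
  by move=> i; rewrite /s1 /= /upd /= hb !inE hK -[i == b :> nat]/(i == b); case: eqVneq.
have m3 : stores s1 3 (C :\ b).
  by move=> i; rewrite /s1 /= /upd /= hb !inE hC -[i == b :> nat]/(i == b); case: eqVneq.
have hi1 : inp s1 by case: hi => *; split.
have b1 : imem s1 10 0 = b by [].
clearbody s1.
pose Inv (k : nat) s2 := forall i : 'I_n,
  imem s2 3 i = (if i < k then i \in [set j in C | spec M b j] :\ b else i \in C :\ b).
have : Inv (n + 0) (run c s1).
  apply: run_for => //; [exact: inp_size hi1|].
  move=> k s2; rewrite addn0 => kn ag ih.
  pose ko := Ordinal kn; set s3 := seti s2 23 0 k.
  have hi3 : inp s3 by apply: (inp_agree ag).
  have b3 : ieval s3 (var 10) = b by apply: etrans (ag.1 10%N 0%N isT) b1.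
  have k3 : ieval s3 (var 23) = ko by [].
  rewrite run_if (beval_spec hi3 b3 k3) => i.
  rewrite ltnS leq_eqVlt -[i == k :> nat]/(i == ko).
  have := ih i; case: (eqVneq i ko) => [->|ni] /=.
    rewrite ltnn !inE => e; case: ifP => sb; first by rewrite andbT.
    by rewrite /= /upd /= eqxx !andbF.
  move=> <-; case: ifP => _ //.
  by rewrite /= /upd /= -[i == k :> nat]/(i == ko) (negbTE ni).
have e4 : forall i, imem (run c s1) 4 i = imem s1 4 i by move=> i; rewrite (agree_run c s1).1.
move=> inv; split=> i; first by rewrite inv addn0 ltn_ord.
by rewrite e4.
Qed.

Lemma grow_clique_spec s K C : inp s -> stores s 3 C -> stores s 4 K ->
  let s' := run grow_clique s in
  exists K' C', [/\ stores s' 3 C', stores s' 4 K' & greedy_step (spec M) K C K' C'].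
Proof.
move=> hi hC hK s'; rewrite /s' /grow_clique 2!run_block run_block0.
have := best_vertex_spec hi hC; cbv zeta.
have ag := agree_run best_vertex s.
have hi1 : inp (run best_vertex s) by apply: (inp_agree ag).
have hC1 : stores (run best_vertex s) 3 C by apply: (stores_agree ag).
have hK1 : stores (run best_vertex s) 4 K by apply: (stores_agree ag).
move: (run best_vertex s) hi1 hC1 hK1 => s1 hi1 hC1 hK1 {ag}.
rewrite run_if; case=> [[z C0]|[b [bC lt e10 bmax]]].
  exists K, C; rewrite ifF; last by rewrite /beval /ieval z.
  by split=> //; left.
rewrite ifT; last by rewrite /beval /ieval.
have [h3 h4] := take_vertex_spec hi1 hC1 hK1 e10.
by eexists; eexists; split; [exact: h3|exact: h4|right; exists b].
Qed.

Lemma find_clique_spec t s V : 0 < t -> block_free t (spec M) ->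
  inp s -> stores s 2 V ->
  let s' := run find_clique s in
  exists K C, stores s' 4 K /\ greedy_inv (spec M) t V n K C.
Proof.
move=> t0 bf hi hV s'; rewrite /s' /find_clique 2!run_block run_block0.
set c := CFor 22 _ _; set c' := CFor 21 _ _.
have : stores (run c s) 3 V /\ stores (run c s) 4 (set0 : {set 'I_n}).
  pose Inv (k : nat) s2 := forall i : 'I_n, i < k ->
    imem s2 3 i = (i \in V) /\ imem s2 4 i = 0.
  suff H : Inv (n + 0) (run c s) by split=> i; have [|h3 h4] := H i; rewrite ?addn0 // ?inE ?h3 ?h4.
  apply: run_for => //; [exact: inp_size hi|].
  move=> k s2; rewrite addn0 => kn ag ih i; rewrite ltnS leq_eqVlt.
  rewrite 2!run_block run_block0 /= /upd /=.
  case: (eqVneq (i : nat) k) => [e _|_ /=]; last exact: ih.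
  by rewrite (ag.1 2%N _ isT) -e hV.
have hi1 : inp (run c s) by apply: (inp_agree (agree_run c s)).
move: (run c s) hi1 => s1 hi1 [h3 h4].
pose Inv (k : nat) s2 := exists K C, [/\ stores s2 3 C, stores s2 4 K
  & greedy_inv (spec M) t V k K C].
suff : Inv (n + 0) (run c' s1).
  by rewrite /Inv addn0 => -[K [C [_ m4 g]]]; exists K, C.
apply: run_for => //; [exact: inp_size hi1| |].
  by exists set0, V; split=> //; apply: greedy_inv0.
move=> k s2; rewrite addn0 => kn ag [K [C [m3 m4 g]]].
have hi2 : inp (seti s2 21 0 k) by apply: (inp_agree ag).
have m3' : stores (seti s2 21 0 k) 3 C by [].
have m4' : stores (seti s2 21 0 k) 4 K by [].
have [K' [C' [m3'' m4'' st]]] := grow_clique_spec hi2 m3' m4'.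
exists K', C'; split=> //.
exact: (greedy_inv_step t0 bf (spec_refl M_partial) (spec_sym M_partial) g st).
Qed.
End FindClique.

(** * Deleting vertices *)

Definition test_vertex :=
  block [:: assign 7 (ICst 1);
    CFor 25 0 (CIf (BAnd (maskE 2 (var 25)) (specE (var 25) (var 24))) test_pair CSkip)].

(** The scan stops at the first deletion, since afterwards [K] is no longer contained in [V]; the
    next round computes a new clique. *)
Definition scan_clique :=
  block [:: assign 6 (ICst 0);
    CFor 24 0 (CIf (BAnd (maskE 4 (var 24)) (ILe (var 6) (ICst 0)))
      (block [:: test_vertex;
         CIf (ILe (ICst 1) (var 7))
           (block [:: assign 6 (ICst 1); CIStore 2 (var 24) (ICst 0)]) CSkip]) CSkip)].

Definition reduce_instance :=
  CFor 20 0 (CIf (ILe (var 5) (ICst 0)) (block [:: find_clique; scan_clique]) CSkip).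

(** The threshold of [redundant_row] for rank [d.+3]; [kernel_bound] is the threshold of
    [greedy_inv] for a clique of this size. *)
Definition clique_size d t := 2 * d.+3 * (t * (4 * d.+3) ^ t).
Definition kernel_bound d t := 2 * (t * (8 * clique_size d t) ^ t).

Section Reduction.
Variables (R : realType) (n d : nat) (M : 'M[option R]_n).
Hypothesis M_partial : partial_matrix M.
Implicit Types (s : state R) (K V C : {set 'I_n}).

Notation inp s := (outputs_instance s d M).
Notation realizable := (realizable d M).

(** The obstruction to deleting [v], which [redundant_row] excludes for some vertex of a large
    clique. *)
Definition locked_by K V (v : 'I_n) := exists2 u, u \in V & spec M u v /\
  ~~ (row v (lift_mx M K) <= row_span (lift_mx M K) (nbrs M K u :\ v))%MS.

Definition answer_inv V s0 s :=
  (imem s 5 0 = imem s0 5 0 \/ imem s 5 0 = 2 /\ ~ realizable V) /\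
  (imem s0 5 0 = 2 -> imem s 5 0 = 2).

Lemma bad_pair_unrealizable K V u v : K \subset V -> clique (spec M) K -> v \in K ->
  u \in V -> spec M u v -> bad_pair d M K u v -> ~ realizable V.
Proof.
move=> KV cK vK uV suv bad rV; case: bad => [[l dl]|].
  by rewrite (dependency_forces M_partial rV KV cK vK uV suv dl) eqxx.
rewrite ltnNge (lift_mx_rank rV KV cK) //.
by apply/subsetP => b; rewrite inE => /andP[].
Qed.

Lemma test_vertex_spec s K V (v : 'I_n) : inp s -> stores s 2 V -> stores s 4 K ->
  imem s 24 0 = v -> v \in K -> K \subset V -> clique (spec M) K ->
  let s' := run test_vertex s in
  [/\ answer_inv V s s',
      imem s' 5 0 <> 2 -> \rank (mask_rows K (lift_mx M K)) <= d.+3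
    & imem s' 7 0 = 0 /\ locked_by K V v \/
      imem s' 7 0 = 1 /\ (imem s' 5 0 = 2 \/ (realizable (V :\ v) -> realizable V))].
Proof.
move=> hi hV hK hv vK KV cK s'; rewrite /s' /test_vertex 2!run_block run_block0.
set s1 := run (assign _ _) s; set c := CFor _ _ _.
pose Inv (k : nat) s2 :=
  [/\ answer_inv V s s2,
      imem s2 5 0 <> 2 -> v < k -> \rank (mask_rows K (lift_mx M K)) <= d.+3
    & imem s2 7 0 = 0 /\ locked_by K V v \/
      imem s2 7 0 = 1 /\ (imem s2 5 0 = 2 \/
        forall u : 'I_n, u \in V -> u < k -> spec M u v ->
          exists2 l, dependency M K u v l &
            dst M u v = (\sum_b l b * dst M u b)%R)].
(* The test of [v] against itself loads all rows of [K], so its pivot count bounds the rank of the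
   whole clique; hence the condition [v < k] in the invariant. *)
have nbrs_v : nbrs M K v = K.
  by apply/setP => b; rewrite inE andbC; case bK: (b \in K); rewrite ?andbF // cK.
have hi1 : inp s1 by apply: (inp_agree (agree_run _ s)).
have : Inv (n + 0) (run c s1).
  apply: run_for => //; first exact: inp_size hi.
    by split=> //; [split; [left|]|right; split=> //; right].
  move=> k s2; rewrite addn0 => kn ag ih.
  pose ko := Ordinal kn; set s3 := seti s2 25 0 k.
  have hi3 : inp s3 by apply: (inp_agree ag).
  have hK3 : stores s3 4 K by apply: (stores_agree ag).
  have hV3 : stores s3 2 V by apply: (stores_agree ag).
  have v3 : ieval s3 (var 24) = v by apply: etrans (ag.1 24%N 0%N isT) hv.
  have k3 : ieval s3 (var 25) = ko by [].
  have ih3 : Inv k s3 by [].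
  have kS (i : 'I_n) : i < k.+1 -> i = ko \/ i < k.
    by rewrite ltnS leq_eqVlt => /orP[/eqP e|]; [left; apply: val_inj|right].
  clearbody s3; clear ih.
  rewrite run_if beval_and (beval_stores hV3 k3) (beval_spec hi3 k3 v3).
  case: ifP => cond; last first.
    have nko u : u = ko -> u \in V -> spec M u v -> False.
      by move=> -> a b; rewrite a b in cond.
    case: ih3 => i1 i2 i3; split=> // [ne /kS[e|lt]|].
    + by case: (nko v) => //; [exact: (subsetP KV)|exact: spec_refl].
    + exact: i2.
    + case: i3 => [|[e7 h]]; [by left|right; split=> //].
      case: h => [|h]; [by left|right=> u uV /kS[e|lt] suv]; last exact: h.
      by case: (nko u).
  case/andP: cond => kV skv.
  have vS : v \in nbrs M K ko by rewrite inE vK.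
  have [t1 t2 t3 t4] := test_pair_spec hi3 hK3 k3 v3 vS.
  move: (run test_pair s3) t1 t2 t3 t4 => s4 t1 t2 t3 t4.
  case: ih3 => -[i1 i1'] i2 i3; split.
  - split=> [|/i1'/t2//].
    case: t1 => [->|[e5 bad]]; first exact: i1.
    right; split=> //.
    exact: bad_pair_unrealizable KV cK vK kV skv bad.
  - move=> ne /kS[e|]; last by apply: i2 => /t2.
    by have := t3 ne; rewrite -e nbrs_v.
  - case: t4 => [[e7 nr]|[e7 h]]; first by left; split=> //; exists ko.
    rewrite e7; case: i3 => [|[e7' h']]; [by left|right].
    split=> //; case: h => [|h]; first by left.
    case: h' => [/t2|h']; first by left.
    by right=> u uV /kS[->|]; [|exact: h'].
move: (run c s1) => s2 [i1 i2 i3]; split=> // [ne|].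
  by apply: i2; rewrite ?addn0.
case: i3 => [|[e7 h]]; [by left|right; split=> //].
case: h => [|h]; [by left|right].
apply: (realizable_delete M_partial KV cK vK) => u uV suv.
by apply: h => //; rewrite addn0.
Qed.

Lemma scan_clique_spec s K V : inp s -> stores s 2 V -> stores s 4 K ->
  K \subset V -> clique (spec M) K ->
  let s' := run scan_clique s in
  answer_inv V s s' /\
  (stores s' 2 V /\ (forall v, v \in K -> imem s' 5 0 <> 2 ->
       \rank (mask_rows K (lift_mx M K)) <= d.+3 /\ locked_by K V v) \/
   exists2 v, v \in V & stores s' 2 (V :\ v) /\
     (imem s' 5 0 = 2 \/ (realizable (V :\ v) -> realizable V))).
Proof.
move=> hi hV hK KV cK s'; rewrite /s' /scan_clique 2!run_block run_block0.
set s1 := run (assign _ _) s; set c := CFor _ _ _.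
pose Inv (k : nat) s2 := answer_inv V s s2 /\
  (imem s2 6 0 = 0 /\ stores s2 2 V /\ (forall v : 'I_n, v \in K -> v < k -> imem s2 5 0 <> 2 ->
       \rank (mask_rows K (lift_mx M K)) <= d.+3 /\ locked_by K V v) \/
   0 < imem s2 6 0 /\ exists2 v, v \in V & stores s2 2 (V :\ v) /\
     (imem s2 5 0 = 2 \/ (realizable (V :\ v) -> realizable V))).
have hi1 : inp s1 by apply: (inp_agree (agree_run _ s)).
have : Inv (n + 0) (run c s1).
  apply: run_for => //; first exact: inp_size hi.
    by split; [split; [left|]|left].
  move=> k s2; rewrite addn0 => kn ag ih.
  pose ko := Ordinal kn; set s3 := seti s2 24 0 k.
  have hi3 : inp s3 by apply: (inp_agree ag).
  have hK3 : stores s3 4 K by apply: (stores_agree ag).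
  have k3 : ieval s3 (var 24) = ko by [].
  have ih3 : Inv k s3 by [].
  have kS (i : 'I_n) : i < k.+1 -> i = ko \/ i < k.
    by rewrite ltnS leq_eqVlt => /orP[/eqP e|]; [left; apply: val_inj|right].
  clearbody s3; clear ih.
  rewrite run_if beval_and (beval_stores hK3 k3).
  case: ih3 => -[a1 a2] [[e6 [hV3 h]]|[e6 h]]; last first.
    rewrite ifF; last by rewrite /beval /ieval leqNgt e6 andbF.
    by split; [split|right].
  have -> : beval s3 (ILe (var 6) (ICst 0)) by rewrite /beval /ieval e6.
  rewrite andbT; case: ifP => kK; last first.
    split; first by split.
    by left; split=> //; split=> // v vK /kS[e|]; [rewrite -e vK in kK|exact: h].
  rewrite 2!run_block run_block0.
  have [t1 t2 t3] := test_vertex_spec hi3 hV3 hK3 k3 kK KV cK.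
  have ag3 := agree_run test_vertex s3.
  move: (run test_vertex s3) ag3 t1 t2 t3 => s4 ag3 [t1 t1'] t2 t3.
  have e6' : imem s4 6 0 = 0 by rewrite (ag3.1 6%N _ isT).
  have k4 : imem s4 24 0 = k by rewrite (ag3.1 24%N _ isT).
  have hV4 : stores s4 2 V by apply: (stores_agree ag3).
  have aa : answer_inv V s s4.
    split=> [|/a2/t1'//]; case: t1 => [->|]; [exact: a1|by right].
  rewrite run_if; case: t3 => [[e7 lk]|[e7 del]].
    rewrite ifF; last by rewrite /beval /ieval e7.
    split=> //; left; split=> //; split=> // v vK /kS[->|vk] ne.
      by split=> //; apply: t2.
    by apply: h => // e5; apply: ne; apply: t1'.
  rewrite ifT; last by rewrite /beval /ieval e7.
  rewrite 2!run_block run_block0; split=> //; right; split=> //.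
  exists ko; first exact: (subsetP KV).
  split=> // i; rewrite /= /upd /= k4 !inE hV4.
  by rewrite -[i == k :> nat]/(i == ko); case: eqVneq.
case=> aa [[e6 [h1 h2]]|[_ h]]; split=> //; [left|by right].
split=> // v vK; apply: h2 => //; by rewrite addn0.
Qed.

Lemma realizableS V V' : V \subset V' -> realizable V' -> realizable V.
Proof. by move=> sub [p rp]; exists p; apply: realizesS rp. Qed.

Lemma kernel_bound_gt0 t : 0 < t -> 0 < kernel_bound d t.
Proof.
by move=> t0; rewrite !muln_gt0 t0 expn_gt0 !muln_gt0 t0 expn_gt0.
Qed.

(** Were [V] larger, the greedy clique would reach [clique_size d t], and [redundant_row] would
    produce a vertex that nothing locks. *)
Lemma locked_clique_small t K V C : 0 < t -> block_free t (spec M) ->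
  greedy_inv (spec M) t V n K C ->
  (forall v, v \in K -> \rank (mask_rows K (lift_mx M K)) <= d.+3 /\ locked_by K V v) ->
  #|V| < kernel_bound d t.
Proof.
move=> t0 bf [[KV CV _ cK _] size_inv] lk; rewrite ltnNge; apply/negP => big.
have s0 : 0 < clique_size d t by rewrite !muln_gt0 t0 expn_gt0.
have [sK _] := size_inv _ s0 big.
(* The search makes [n] steps and so guarantees only the minimum of [n] and the target. *)
have sn : clique_size d t <= n.
  have cV : #|V| <= n by rewrite -[X in _ <= X]card_ord max_card.
  apply: leq_trans cV; apply: leq_trans big.
  rewrite /kernel_bound; apply: leq_trans (_ : (8 * clique_size d t) ^ t <= _); last first.
    by rewrite mulnA leq_pmull // muln_gt0.
  apply: leq_trans (_ : (8 * clique_size d t) ^ 1 <= _).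
    by rewrite expn1 leq_pmull.
  by rewrite leq_pexp2l // muln_gt0.
rewrite (minn_idPr sn) in sK.
have [v0 v0K] : exists v, v \in K.
  by apply/card_gt0P; apply: leq_trans sK.
have [rk _] := lk _ v0K.
have rkK : \rank (row_span (lift_mx M K) K) <= d.+3.
  apply: leq_trans rk; apply: mxrankS; apply: row_span_le => i iK.
  have -> : row i (lift_mx M K) = row i (mask_rows K (lift_mx M K)).
    by apply/rowP => k; rewrite !mxE iK mul1r.
  exact: row_sub.
have [v vK hv] := redundant_row t0 (ltn0Sn _) bf rkK sK.
have [_ [u uV [suv]]] := lk v vK.
by rewrite -/(nbrs M K u) hv.
Qed.

Lemma reduce_instance_spec t s : 0 < t -> block_free t (spec M) ->
  inp s -> imem s 5 0 = 0 -> stores s 2 [set: 'I_n] ->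
  let s' := run reduce_instance s in
  (imem s' 5 0 = 2 /\ ~ realizable [set: 'I_n]) \/
  imem s' 5 0 = 0 /\ exists V, [/\ stores s' 2 V, #|V| < kernel_bound d t
     & realizable V -> realizable [set: 'I_n]].
Proof.
move=> t0 bf hi h5 hV s'; rewrite /s' /reduce_instance.
(* Unless the answer is no, every round deletes a vertex or shows that [V] is below the bound; after
   [n] rounds the first alternative leaves [V] empty. *)
pose Inv (k : nat) s2 :=
  (imem s2 5 0 = 2 /\ ~ realizable [set: 'I_n]) \/
  imem s2 5 0 = 0 /\ exists V, [/\ stores s2 2 V,
     #|V| <= n - k \/ #|V| < kernel_bound d t
     & realizable V -> realizable [set: 'I_n]].
set c := CFor _ _ _.
have : Inv (n + 0) (run c s).
  apply: run_for => //; first exact: inp_size hi.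
    right; split=> //; exists [set: 'I_n]; split=> //; left.
    by rewrite subn0 cardsT card_ord.
  move=> k s2; rewrite addn0 => kn ag ih.
  set s3 := seti s2 20 0 k.
  have hi3 : inp s3 by apply: (inp_agree ag).
  have ih3 : Inv k s3 by [].
  clearbody s3; clear ih; rewrite run_if.
  case: ih3 => [[e5 nr]|[e5 [V [hV3 cV rV]]]].
    by rewrite ifF; [left|rewrite /beval /ieval e5].
  rewrite ifT; last by rewrite /beval /ieval e5.
  rewrite 2!run_block run_block0.
  have [K [C [hK g]]] := find_clique_spec M_partial t0 bf hi3 hV3.
  have ag3 := agree_run find_clique s3.
  move: (run find_clique s3) ag3 hK => s4 ag3 hK.
  have hi4 : inp s4 by apply: (inp_agree ag3).
  have hV4 : stores s4 2 V by apply: (stores_agree ag3).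
  have e54 : imem s4 5 0 = 0 by rewrite (ag3.1 5%N _ isT).
  have [[KV _ _ cK _] _] := g.
  have [[a1 _] h] := scan_clique_spec hi4 hV4 hK KV cK.
  move: (run scan_clique s4) a1 h => s5; rewrite e54 => a1 h.
  case: a1 => [e55|[e55 nr]]; last first.
    by left; split=> // r; apply: nr; apply: realizableS r.
  right; split=> //; case: h => [[hV5 lk]|[v vV [hV5 del]]].
    exists V; split=> //; right.
    apply: (locked_clique_small t0 bf g) => v vK.
    by apply: lk => //; rewrite e55.
  exists (V :\ v); split=> //.
  - case: cV => cV; [left|right]; last first.
      by apply: leq_ltn_trans cV; rewrite subset_leq_card // subD1set.
    by move: cV; rewrite (cardsD1 v V) vV /=; clear -kn; lia.
  - by case: del => [|del r]; [rewrite e55|apply/rV/del].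
move=> [|[e5 [V [h1 h2 h3]]]]; [by left|right; split=> //].
exists V; split=> //; case: h2 => //; rewrite addn0 subnn leqn0 => /eqP->.
exact: kernel_bound_gt0.
Qed.
End Reduction.

(** * Extracting the submatrix *)

Definition list_vertices :=
  block [:: assign 14 (ICst 0);
    CFor 22 0 (CIf (maskE 2 (var 22))
      (block [:: CIStore 15 (var 14) (var 22); incr 14]) CSkip)].

(** The submatrix goes to the same arrays with a different row width; a copy spares the argument
    that no cell is overwritten before it is read. *)
Definition save_instance :=
  CFor 22 0 (CFor 23 0 (block [::
    CIStore 16 (cellE (var 22) (var 23)) (ILoad 1 (cellE (var 22) (var 23)));
    CRStore 3 (cellE (var 22) (var 23)) (RLoad 0 (cellE (var 22) (var 23)))])).

Definition newcellE := IAdd (IMul (var 22) (var 14)) (var 23).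
Definition oldcellE := cellE (ILoad 15 (var 22)) (ILoad 15 (var 23)).

(** Loops can only run up to [n] plus a constant, so the guard cuts both of them off at the new
    size. *)
Definition write_submatrix :=
  CFor 22 0 (CFor 23 0
    (CIf (BAnd (ILe (IAdd (var 22) (ICst 1)) (var 14)) (ILe (IAdd (var 23) (ICst 1)) (var 14)))
       (block [:: CIStore 1 newcellE (ILoad 16 oldcellE);
                  CRStore 0 newcellE (RLoad 3 oldcellE)]) CSkip)).

Definition compact := block [:: list_vertices; save_instance; write_submatrix].

Section Compaction.
Variables (R : realType) (n d : nat) (M : 'M[option R]_n).
Implicit Types (s : state R) (V : {set 'I_n}).

Notation inp s := (outputs_instance s d M).

Lemma list_vertices_spec s V : imem s 0 1 = n -> stores s 2 V ->
  exists m (f : 'I_m -> 'I_n), [/\ {homo f : i j / i < j}, m = #|V|,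
    forall i, (i \in V) = [exists k, f k == i]
    & imem (run list_vertices s) 14 0 = m /\
      forall k : 'I_m, imem (run list_vertices s) 15 k = f k].
Proof.
move=> hn hV; pose P k := 0 < imem s 2 k.
pose L k := filter P (iota 0 k).
have Ln j : j < size (L n) -> nth 0 (L n) j < n.
  by move=> /(mem_nth 0); rewrite mem_filter mem_iota => /andP[].
have LV (i : 'I_n) : (nat_of_ord i \in L n) = (i \in V).
  by rewrite mem_filter mem_iota /= ltn_ord andbT /P hV; case: (i \in V).
pose f (k : 'I_(size (L n))) : 'I_n := Ordinal (Ln k (ltn_ord k)).
have hf : {homo f : i j / i < j}.
  have sL : sorted ltn (L n).
    by apply: sorted_filter; [exact: ltn_trans|exact: iota_ltn_sorted].
  by move=> i j ij /=; apply: (sorted_ltn_nth ltn_trans 0 sL); rewrite ?inE.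
have fV i : (i \in V) = [exists k, f k == i].
  rewrite -LV; apply/idP/existsP => [iL|[k /eqP<-]]; last by rewrite /= mem_nth.
  have lt : index (nat_of_ord i) (L n) < size (L n) by rewrite index_mem.
  by exists (Ordinal lt); apply/eqP/val_inj; rewrite /= nth_index.
exists (size (L n)), f; split=> //.
  have injf : injective f.
    move=> i j e; apply: val_inj; case: (ltngtP i j) => // /hf; rewrite e ltnn //.
  have -> : V = [set f k | k in [set: 'I_(size (L n))]].
    apply/setP => i; rewrite fV; apply/existsP/imsetP => [[k /eqP<-]|[k _ ->]].
      by exists k.
    by exists k.
  by rewrite card_imset // cardsT card_ord.
rewrite /list_vertices 2!run_block run_block0.
set s1 := run (assign _ _) s; set c := CFor _ _ _.
pose Inv (k : nat) s2 := imem s2 14 0 = size (L k) /\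
  forall j, j < size (L k) -> imem s2 15 j = nth 0 (L k) j.
suff [h1 h2] : Inv (n + 0) (run c s1).
  by rewrite addn0 in h1 h2; split=> // k; rewrite h2.
apply: run_for => // k s2; rewrite addn0 => kn ag [h1 h2].
have eL : L k.+1 = L k ++ (if P k then [:: k] else [::]).
  by rewrite /L -addn1 iotaD filter_cat.
rewrite /Inv eL run_if.
have -> : beval (seti s2 22 0 k) (maskE 2 (var 22)) = P k.
  by rewrite /= /upd /= (ag.1 2%N _ isT).
case: ifP => _; last by rewrite cats0; split.
rewrite 2!run_block run_block0 size_cat /= /upd /= h1 !addn1.
split=> // j.
rewrite ltnS leq_eqVlt nth_cat.
case: (ltngtP j (size (L k))) => // [jl _|->]; first exact: h2.
by rewrite subnn.
Qed.

Lemma save_instance_spec s : inp s ->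
  let s' := run save_instance s in
  forall i j : 'I_n, imem s' 16 (i * n + j) = spec M i j /\
    rmem s' 3 (i * n + j) = dst M i j.
Proof.
move=> hi s'; rewrite /s' /save_instance.
pose Inv (k : nat) s1 := forall i j : 'I_n, i < k ->
  imem s1 16 (i * n + j) = spec M i j /\ rmem s1 3 (i * n + j) = dst M i j.
set c := CFor _ _ _.
suff H : Inv (n + 0) (run c s) by move=> i j; apply: H; rewrite addn0.
apply: run_for => //; first exact: inp_size hi.
move=> k s1; rewrite addn0 => kn ag ih; pose ko := Ordinal kn.
pose Inv2 (l : nat) s2 := forall i j : 'I_n, (i < k) || (i == ko) && (j < l) ->
  imem s2 16 (i * n + j) = spec M i j /\ rmem s2 3 (i * n + j) = dst M i j.
set s2 := seti s1 22 0 k; set c2 := CFor _ _ _.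
have hi2 : inp s2 by apply: (inp_agree ag).
have : Inv2 (n + 0) (run c2 s2).
  apply: run_for => //; first exact: inp_size hi2.
    by move=> i j; rewrite ltn0 andbF orbF; apply: ih.
  move=> l s3; rewrite addn0 => ln ag3 ih3 i j; pose lo := Ordinal ln.
  set s4 := seti s3 23 0 l.
  have hi4 : inp s4 by apply: (inp_agree ag3).
  have k4 : imem s4 22 0 = ko by apply: (ag3.1 22%N 0%N isT).
  have l4 : imem s4 23 0 = lo by [].
  have ih4 : Inv2 l s4 by [].
  clearbody s4; rewrite 2!run_block run_block0.
  have [_ n4 _ hs hd] := hi4.
  rewrite /= /upd /= k4 l4 n4 hs hd cell_inj //.
  rewrite -[i == k :> nat]/(i == ko) -[j == l :> nat]/(j == lo).
  case: (eqVneq i ko) => [->|_] /=; last by rewrite orbF => ik; apply: ih4; rewrite ik.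
  case: (eqVneq j lo) => [->|nj] //=.
  rewrite ltnn [j < l.+1]ltnS [j <= l]leq_eqVlt -[j == l :> nat]/(j == lo).
  rewrite (negbTE nj) /= => jl.
  by apply: (ih4 ko j); rewrite eqxx jl orbT.
move=> h i j; rewrite ltnS leq_eqVlt -[i == k :> nat]/(i == ko) => ik.
by apply: h; rewrite addn0 ltn_ord andbT orbC.
Qed.

Lemma write_submatrix_spec s m (f : 'I_m -> 'I_n) : m <= n -> imem s 0 1 = n ->
  imem s 14 0 = m -> (forall k : 'I_m, imem s 15 k = f k) ->
  (forall i j : 'I_n, imem s 16 (i * n + j) = spec M i j /\
    rmem s 3 (i * n + j) = dst M i j) ->
  let s' := run write_submatrix s in
  forall i j : 'I_m, imem s' 1 (i * m + j) = spec M (f i) (f j) /\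
    rmem s' 0 (i * m + j) = dst M (f i) (f j).
Proof.
move=> mn hn hm hf hs s'; rewrite /s' /write_submatrix.
pose Inv (k : nat) s1 := forall i j : 'I_m, i < k ->
  imem s1 1 (i * m + j) = spec M (f i) (f j) /\ rmem s1 0 (i * m + j) = dst M (f i) (f j).
set c := CFor _ _ _.
suff H : Inv (n + 0) (run c s).
  by move=> i j; apply: H; rewrite addn0 (leq_trans _ mn).
apply: run_for => //.
move=> k s1; rewrite addn0 => kn ag ih.
pose Inv2 (l : nat) s2 := forall i j : 'I_m, (i < k) || (i == k :> nat) && (j < l) ->
  imem s2 1 (i * m + j) = spec M (f i) (f j) /\ rmem s2 0 (i * m + j) = dst M (f i) (f j).
set s2 := seti s1 22 0 k; set c2 := CFor _ _ _.
have n2 : imem s2 0 1 = n by exact: etrans (ag.1 0%N 1%N isT) hn.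
have m2 : imem s2 14 0 = m by exact: etrans (ag.1 14%N 0%N isT) hm.
have f2 (i : 'I_m) : imem s2 15 i = f i by exact: etrans (ag.1 15%N _ isT) (hf i).
have h2 (i j : 'I_n) : imem s2 16 (i * n + j) = spec M i j /\
    rmem s2 3 (i * n + j) = dst M i j.
  by rewrite -[imem s2 16 _]/(imem s1 16 _) -[rmem s2 3 _]/(rmem s1 3 _)
    (ag.1 16%N _ isT) (ag.2 3%N _ isT).
have : Inv2 (n + 0) (run c2 s2).
  apply: run_for => //.
    by move=> i j; rewrite ltn0 andbF orbF; apply: ih.
  move=> l s3; rewrite addn0 => ln ag3 ih3 i j.
  set s4 := seti s3 23 0 l.
  have n4 : imem s4 0 1 = n by exact: etrans (ag3.1 0%N 1%N isT) n2.
  have m4 : imem s4 14 0 = m by exact: etrans (ag3.1 14%N 0%N isT) m2.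
  have f4 (a : 'I_m) : imem s4 15 a = f a by exact: etrans (ag3.1 15%N _ isT) (f2 a).
  have h4 (a b : 'I_n) : imem s4 16 (a * n + b) = spec M a b /\
      rmem s4 3 (a * n + b) = dst M a b.
    by rewrite -[imem s4 16 _]/(imem s3 16 _) -[rmem s4 3 _]/(rmem s3 3 _)
      (ag3.1 16%N _ isT) (ag3.2 3%N _ isT).
  have k4 : imem s4 22 0 = k by apply: (ag3.1 22%N 0%N isT).
  have l4 : imem s4 23 0 = l by [].
  have ih4 : Inv2 l s4 by [].
  clearbody s4; rewrite run_if.
  have -> : beval s4 (BAnd (ILe (IAdd (var 22) (ICst 1)) (var 14))
      (ILe (IAdd (var 23) (ICst 1)) (var 14))) = (k < m) && (l < m).
    by rewrite /= k4 l4 m4 !addn1.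
  case: ifP => [/andP[km lm]|out]; last first.
    move=> h; apply: ih4; case/orP: h => [->//|/andP[/eqP ik]].
    rewrite ltnS leq_eqVlt => /orP[/eqP jl|jl]; last by rewrite ik eqxx jl orbT.
    by rewrite -ik -jl !ltn_ord in out.
  rewrite 2!run_block run_block0.
  pose ko := Ordinal km; pose lo := Ordinal lm.
  rewrite /= /upd /= k4 l4 n4 m4 -[k]/(nat_of_ord ko) -[l]/(nat_of_ord lo) !f4.
  rewrite (h4 (f ko) (f lo)).1 (h4 (f ko) (f lo)).2 cell_inj //.
  rewrite -[i == ko :> nat]/(i == ko) -[j == lo :> nat]/(j == lo).
  case: (eqVneq i ko) => [->|ni] /=; last by rewrite orbF => ik; apply: ih4; rewrite ik.
  case: (eqVneq j lo) => [->|nj] //=.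
  rewrite ltnn [j < l.+1]ltnS [j <= l]leq_eqVlt -[j == l :> nat]/(j == lo).
  rewrite (negbTE nj) /= => jl.
  by apply: (ih4 ko j); rewrite eqxx jl orbT.
move=> h i j; rewrite ltnS leq_eqVlt => ik.
by apply: h; rewrite addn0 (leq_trans (ltn_ord j) mn) andbT orbC.
Qed.

Lemma compact_spec s V : inp s -> stores s 2 V ->
  let s' := run compact s in
  exists m (f : 'I_m -> 'I_n), [/\ {homo f : i j / i < j}, m = #|V|,
    forall i, (i \in V) = [exists k, f k == i], imem s' 14 0 = m
    & forall i j : 'I_m, imem s' 1 (i * m + j) = spec M (f i) (f j) /\
        rmem s' 0 (i * m + j) = dst M (f i) (f j)].
Proof.
move=> hi hV s'; rewrite /s' /compact 3!run_block run_block0.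
have [m [f [hf mV fV [e14 e15]]]] := list_vertices_spec (inp_size hi) hV.
exists m, f; split=> //.
- rewrite (agree_run write_submatrix _).1 // (agree_run save_instance _).1 //.
- have hi1 : inp (run list_vertices s) by apply: (inp_agree (agree_run _ s)).
  move: (run list_vertices s) e14 e15 hi1 => s1 e14 e15 hi1.
  have := save_instance_spec hi1.
  have ag := agree_run save_instance s1.
  move: (run save_instance s1) ag => s2 ag h.
  apply: write_submatrix_spec => //.
  + by rewrite mV -[X in _ <= X]card_ord max_card.
  + by rewrite (ag.1 0%N _ isT) (inp_size hi1).
  + by rewrite (ag.1 14%N _ isT).
  + by move=> k; rewrite (ag.1 15%N _ isT).
Qed.
End Compaction.

(** * The kernelization *)

(** In dimension 0 all points coincide, so an instance is realizable exactly when all specified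
    entries vanish. A kernel would be confined here to one row, as [d.+1] is 1. *)
Definition decide_dim0 :=
  block [:: assign 5 (ICst 1);
    CFor 22 0 (CFor 23 0
      (CIf (BAnd (specE (var 22) (var 23)) (rneq0E (RLoad 0 (cellE (var 22) (var 23)))))
         (assign 5 (ICst 2)) CSkip))].

Definition kernelize :=
  block [:: CFor 22 0 (CIStore 2 (var 22) (ICst 1)); reduce_instance; compact].

(** Array 0 is written only at the very end, because its cell 1 bounds the loops. If no refutation
    was found, status 0 is already in place and only the size has to be replaced. *)
Definition main_cmd :=
  CIf (ILe szE (IAdd (ILoad 0 (ICst 2)) (ICst 1))) CSkip
    (CIf (ILe (ILoad 0 (ICst 2)) (ICst 0))
       (CSeq decide_dim0 (CIStore 0 (ICst 0) (var 5)))
       (CSeq kernelize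
          (CIf (ILe (var 5) (ICst 0)) (CIStore 0 (ICst 1) (var 14))
             (CIStore 0 (ICst 0) (ICst 2))))).

Lemma main_cmd_wf : wf main_cmd.
Proof. by []. Qed.

(** With base [b = d.+1], at least 2, constants and [t] become powers of [b], and [d.+3 <= b ^ 2].
    The clique size is then at most [b ^ (8 * t)], eight times it at most [b ^ (11 * t)], and the
    total exponent is [1 + t + 11 * t ^ 2]. *)
Lemma kernel_bound_le d t : 0 < d -> 0 < t -> kernel_bound d t <= d.+1 ^ (13 * t ^ 2).
Proof.
move=> d0 t0; rewrite /kernel_bound /clique_size; set b := d.+1.
have b2 : 2 <= b by [].
have pow k : 2 ^ k <= b ^ k by apply: leq_expl.
have tb : t <= b ^ t by apply: leq_trans (pow t); rewrite ltnW // ltn_expl.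
have b4 : 4 <= b ^ 2 := pow 2.
have b8 : 8 <= b ^ 3 := pow 3.
have bd : d.+3 <= b ^ 2 by rewrite /b; nia.
have c1 : (4 * d.+3) ^ t <= b ^ (4 * t).
  by rewrite expnM leq_expl // (expnD b 2 2) leq_mul.
have c2 : 2 * d.+3 * (t * (4 * d.+3) ^ t) <= b ^ (8 * t).
  apply: leq_trans (_ : b ^ (1 + 2 + (t + 4 * t)) <= _).
    rewrite (expnD b (1 + 2)) (expnD b 1) (expnD b t) expn1.
    by do 2 apply: leq_mul => //.
  by rewrite leq_pexp2l //; lia.
have c3 : (8 * (2 * d.+3 * (t * (4 * d.+3) ^ t))) ^ t <= b ^ (11 * t * t).
  rewrite [X in _ <= X]expnM leq_expl //.
  apply: leq_trans (leq_mul b8 c2) _; rewrite -expnD leq_pexp2l //; lia.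
apply: leq_trans (_ : b ^ (1 + (t + 11 * t * t)) <= _).
  by rewrite (expnD b 1) (expnD b t) expn1; do 2 apply: leq_mul => //.
by rewrite leq_pexp2l //; nia.
Qed.

(** * Correctness of the whole program *)

Section Main.
Variables (R : realType) (n d : nat) (M : 'M[option R]_n).
Implicit Types (s : state R) (V : {set 'I_n}).

Notation inp s := (outputs_instance s d M).

Lemma run_seq c1 c2 s : run (CSeq c1 c2) s = run c2 (run c1 s).
Proof. by []. Qed.

Lemma spec_Some i j x : M i j = Some x -> spec M i j /\ dst M i j = x.
Proof. by rewrite /spec /dst => ->. Qed.

Lemma dst_Some i j : spec M i j -> M i j = Some (dst M i j).
Proof. by rewrite /spec /dst; case: (M i j). Qed.

(** Links the two views: the reduction shrinks a set of old indices without renumbering, whereas the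
    output is a matrix with indices of its own. *)
Lemma edmc_mxsub m (f : 'I_m -> 'I_n) V : (forall i, (i \in V) = [exists k, f k == i]) ->
  edmc d (mxsub f f M) <-> realizable d M V.
Proof.
move=> fV; split=> [[D [cD [p hp]]]|[p rp]].
  pose q i := if [pick k | f k == i] is Some k then p k else 0%R.
  exists q => i j; rewrite !fV => /existsP[a /eqP ai] /existsP[b /eqP bj] sij.
  rewrite /q; case: pickP => [a' /eqP ai'|/(_ a)]; last by rewrite ai eqxx.
  case: pickP => [b' /eqP bj'|/(_ b)]; last by rewrite bj eqxx.
  rewrite -hp; apply: cD; rewrite mxE ai' bj'; exact: dst_Some.
exists (\matrix_(a, b) sqnorm2 (p (f a) - p (f b)))%R; split.
  move=> a b x; rewrite !mxE => /spec_Some[sab <-].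
  by apply: rp => //; rewrite fV; apply/existsP; [exists a|exists b].
by exists (p \o f) => a b; rewrite mxE.
Qed.

Lemma edmc_realizable : edmc d M <-> realizable d M [set: 'I_n].
Proof.
rewrite -(@edmc_mxsub n id) ?mxsub_id // => i; rewrite inE.
by apply/esym/existsP; exists i.
Qed.

Lemma input_state_outputs : inp (input_state d M).
Proof.
have fl (i j : 'I_n) : flat M (i * n + j) = M i j.
  rewrite /flat divnMDl ?(leq_ltn_trans _ (ltn_ord i)) // divn_small // addn0.
  by rewrite modnMDl modn_small // !valK.
by split=> // i j; rewrite /= fl.
Qed.

(** A common index would give a specified diagonal entry, so sets without a specified pair are
    disjoint and form a block pattern. *)
Lemma excludes_block_free t : partial_matrix M -> excludes_block_pattern t M ->
  block_free t (spec M).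
Proof.
move=> Mp ex I J cI cJ.
have [/exists_inP[i iI /exists_inP[j jJ h]]|no] :=
  boolP [exists i in I, [exists j in J, spec M i j]]; first by exists i, j.
have none i j : i \in I -> j \in J -> spec M i j = false.
  move=> iI jJ; apply: contraNF no => h.
  by apply/exists_inP; exists i => //; apply/exists_inP; exists j.
case: ex; exists I, J; split=> // [|i j iI jJ].
  rewrite -setI_eq0; apply/eqP/setP => i; rewrite !inE; apply/negbTE/andP => -[iI iJ].
  by have := none _ _ iI iJ; rewrite spec_refl.
by have := none _ _ iI jJ; rewrite /spec; case: (M i j).
Qed.

Lemma decide_dim0_spec s : d = 0 -> inp s ->
  let s' := run decide_dim0 s in
  imem s' 5 0 = 1 /\ edmc d M \/ imem s' 5 0 = 2 /\ ~ edmc d M.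
Proof.
move=> d0 hi s'.
have edm0 : edmc d M <-> forall i j, spec M i j -> dst M i j = 0%R.
  have sq0 (x : 'rV[R]_d) : sqnorm2 x = 0%R.
    by rewrite /sqnorm2 big1 // => k; have := ltn_ord k; rewrite {2}d0.
  rewrite edmc_realizable; split=> [[p rp] i j sij|h].
    by rewrite -rp // sq0.
  by exists (fun=> 0%R) => i j _ _ sij; rewrite sq0 h.
rewrite edm0 /s' /decide_dim0 2!run_block run_block0.
set s1 := run (assign _ _) s; set c := CFor _ _ _.
have hi1 : inp s1 by apply: (inp_agree (agree_run _ s)).
pose ok (i j : 'I_n) := spec M i j ==> (dst M i j == 0%R).
pose Inv (k : nat) s2 := imem s2 5 0 =
  if [forall i : 'I_n, [forall j, (i < k) ==> ok i j]] then 1 else 2.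
have : Inv (n + 0) (run c s1).
  apply: run_for => //; first exact: inp_size hi1.
    by rewrite /Inv; case: forallP => // -[] i; apply/forallP.
  move=> k s2; rewrite addn0 => kn ag ih; pose ko := Ordinal kn.
  pose Inv2 (l : nat) s3 := imem s3 5 0 =
    if [forall i : 'I_n, [forall j : 'I_n, (i < k) || (i == ko) && (j < l) ==> ok i j]]
    then 1 else 2.
  set s3 := seti s2 22 0 k; set c2 := CFor _ _ _.
  have hi3 : inp s3 by apply: (inp_agree ag).
  have : Inv2 (n + 0) (run c2 s3).
    apply: run_for => //; first exact: inp_size hi3.
      rewrite /Inv2 -[imem s3 5 0]/(imem s2 5 0) ih; congr (if _ then _ else _).
      by apply: eq_forallb => i; apply: eq_forallb => j; rewrite ltn0 andbF orbF.
    move=> l s4; rewrite addn0 => ln ag4 ih4; pose lo := Ordinal ln.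
    set s5 := seti s4 23 0 l.
    have hi5 : inp s5 by apply: (inp_agree ag4).
    have k5 : ieval s5 (var 22) = ko by apply: (ag4.1 22%N 0%N isT).
    have l5 : ieval s5 (var 23) = lo by [].
    have ih5 : Inv2 l s5 by [].
    clearbody s5; rewrite run_if beval_and beval_rneq0 (beval_spec hi5 k5 l5).
    rewrite (reval_dst hi5 k5 l5).
    have -> : spec M ko lo && (dst M ko lo != 0%R) = ~~ ok ko lo.
      by rewrite /ok negb_imply.
    have eS : [forall i : 'I_n, [forall j : 'I_n, (i < k) || (i == ko) && (j < l.+1) ==> ok i j]]
      = ok ko lo &&
        [forall i : 'I_n, [forall j : 'I_n, (i < k) || (i == ko) && (j < l) ==> ok i j]].
      apply/idP/andP => [/forallP h|[hko /forallP h]].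
        split; first by have /forallP/(_ lo) := h ko; rewrite eqxx ltnSn orbT.
        apply/forallP => i; apply/forallP => j; apply/implyP => c1.
        have /forallP/(_ j)/implyP := h i; apply.
        by case/orP: c1 => [->//|/andP[-> jl]]; rewrite (leqW jl) orbT.
      apply/forallP => i; apply/forallP => j; apply/implyP => c1.
      have /forallP/(_ j)/implyP hi' := h i.
      case/orP: c1 => [ik|/andP[ik]]; first by apply: hi'; rewrite ik.
      rewrite ltnS leq_eqVlt => /orP[jl|jl]; last by apply: hi'; rewrite ik jl orbT.
      by rewrite (eqP ik) (_ : j = lo) //; apply/val_inj/eqP.
    rewrite /Inv2 eS; case: (ok ko lo) => //=; exact: ih5.
  rewrite /Inv2 /Inv => ->; congr (if _ then _ else _).
  apply: eq_forallb => i; apply: eq_forallb => j.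
  by rewrite addn0 ltn_ord andbT ltnS [i <= k]leq_eqVlt orbC.
rewrite /Inv => ->; case: ifP => h; [left|right]; split=> //.
  move=> i j sij; move/forallP/(_ i)/forallP/(_ j): h.
  by rewrite addn0 ltn_ord /ok sij => /eqP.
move=> h'; move/negP: h; apply; apply/forallP => i; apply/forallP => j.
by apply/implyP => _; apply/implyP => /h'->.
Qed.

Lemma kernelize_spec t s : partial_matrix M -> 0 < t -> block_free t (spec M) ->
  inp s -> imem s 5 0 = 0 ->
  let s' := run kernelize s in
  imem s' 5 0 = 2 /\ ~ edmc d M \/
  imem s' 5 0 = 0 /\ exists m (f : 'I_m -> 'I_n), [/\ {homo f : i j / i < j},
    m < kernel_bound d t, edmc d (mxsub f f M) <-> edmc d M,
    imem s' 14 0 = m &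
    forall i j : 'I_m, imem s' 1 (i * m + j) = spec M (f i) (f j) /\
        rmem s' 0 (i * m + j) = dst M (f i) (f j)].
Proof.
move=> Mp t0 bf hi h5 s'; rewrite /s' /kernelize 3!run_block run_block0.
set c := CFor _ _ _; set s1 := run c s.
have ag : agree c s s1 := agree_run c s.
have hi1 : inp s1 by apply: (inp_agree ag).
have h51 : imem s1 5 0 = 0 by rewrite (ag.1 5%N _ isT).
have m1 : stores s1 2 [set: 'I_n].
  pose Inv (k : nat) s2 := forall i : 'I_n, i < k -> imem s2 2 i = 1.
  suff H : Inv (n + 0) s1 by move=> i; rewrite H ?inE ?addn0.
  apply: run_for => //; first exact: inp_size hi.
  move=> k s2; rewrite addn0 => kn ag2 ih i; rewrite ltnS leq_eqVlt.
  by rewrite /= /upd /=; case: (eqVneq (i : nat) k) => //= _; apply: ih.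
clearbody s1.
have := reduce_instance_spec Mp t0 bf hi1 h51 m1; cbv zeta.
have ag1 := agree_run reduce_instance s1.
move: (run reduce_instance s1) ag1 => s2 ag2.
have hi2 : inp s2 by apply: (inp_agree ag2).
have ag3 := agree_run compact s2.
case=> [[e5 nr]|[e5 [V [mV cV rV]]]].
  left; rewrite (ag3.1 5%N _ isT); split=> //.
  by rewrite edmc_realizable.
right; rewrite (ag3.1 5%N _ isT); split=> //.
have [m [f [hf em fV e14 hc]]] := compact_spec hi2 mV.
exists m, f; split=> //; first by rewrite em.
rewrite (edmc_mxsub fV) edmc_realizable; split=> //.
by apply: realizableS; apply: subsetT.
Qed.
End Main.

Theorem mainTheorem2 (R : realType) :
  exists (P : prog) (c C : nat),
    forall (n d t : nat) (M : 'M[option R]_n),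
      partial_matrix M -> 0 < t -> excludes_block_pattern t M ->
      exists (T : nat) (s : state R),
        [/\ exec P (input_state d M) T s,
            T <= c * n.+1 ^ c
          & [\/ answers_yes s /\ edmc d M,
                answers_no s /\ ~ edmc d M
              | exists (m : nat) (M' : 'M[option R]_m),
                  [/\ outputs_instance s d M',
                      principal_submatrix M' M,
                      edmc d M' <-> edmc d M
                    & m <= d.+1 ^ (C * t ^ 2)]]].
Proof.
have [c hc] := cost_poly main_cmd.
exists (compile main_cmd), c, 13 => n d t M Mp t0 ex.
have [T hT lT] := @compile_exec R main_cmd (input_state d M) main_cmd_wf.
exists T, (run main_cmd (input_state d M)); split=> //.
  exact: leq_trans lT (hc n).
have bf := excludes_block_free Mp ex.
have hi := input_state_outputs d M.
move: hi (erefl : imem (input_state d M) 5 0 = 0).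
move: (input_state d M) => s hi h5; have [z hn hd _ _] := hi.
rewrite /main_cmd !run_if.
have -> : beval s (ILe szE (IAdd (ILoad 0 (ICst 2)) (ICst 1))) = (n <= d.+1).
  by rewrite /= hn hd addn1.
have -> : beval s (ILe (ILoad 0 (ICst 2)) (ICst 0)) = (d == 0).
  by rewrite /= hd leqn0.
(* An instance with at most [d.+1] indices is returned unchanged; it meets the bound because the
   exponent is positive. *)
case: leqP => [nd|dn].
  apply: Or33; exists n, M; split=> //.
    by exists id; rewrite ?mxsub_id.
  apply: leq_trans nd _; rewrite -{1}[d.+1]expn1 leq_pexp2l //.
  by rewrite muln_gt0 expn_gt0 t0.
case: eqP => [d0|/eqP d0].
  have [[e5 h]|[e5 h]] := decide_dim0_spec d0 hi.
    by apply: Or31; split=> //; rewrite /answers_yes -e5.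
  by apply: Or32; split=> //; rewrite /answers_no -e5.
have := kernelize_spec Mp t0 bf hi h5; cbv zeta.
rewrite run_seq.
have ag := agree_run kernelize s.
move: (run kernelize s) ag => s1 ag; rewrite run_if.
case=> [[e5 h]|[e5 [m [f [hf lm hm e14 hs]]]]].
  rewrite ifF; last by rewrite /beval /ieval e5.
  exact: Or32.
rewrite ifT; last by rewrite /beval /ieval e5.
apply: Or33; exists m, (mxsub f f M); split=> //.
- split=> [||| i j|i j].
  + by rewrite /= /upd /= (ag.1 0 0 isT).
  + by rewrite /= /upd.
  + by rewrite /= /upd /= (ag.1 0 2 isT).
  + by rewrite /= /upd /= (hs i j).1 mxE.
  + by rewrite /= (hs i j).2 mxE.
- by exists f.
- by apply: leq_trans (ltnW lm) (kernel_bound_le _ t0); rewrite lt0n.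
Qed.
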